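(* Let $1\leq\alpha<\omega_1$ and let $T(\mathcal S_\alpha,1/2)$ be the Tsirelson space of order $\alpha$. Then $I_b(T(\mathcal S_\alpha,1/2))=\omega^{\alpha\cdot\omega}=I(T(\mathcal S_\alpha,1/2))$, where $I$ is the Bourgain $\ell_1$-index and $I_b$ is the block basis $\ell_1$-index with respect to the unit vector basis $(e_i)$.
   Context: Schreier sets. For finite sets $E,F\subseteq\mathbf N$, $E<F$ means $\max E<\min F$; $n\leq F$ means $n\leq\min F$ and $n<F$ means $n<\min F$. For collections $\mathcal M,\mathcal N$ of finite sets of positive integers, $\mathcal M[\mathcal N]$ is the collection of all $\bigcup_1^kF_i$ with $k\ge1$, $F_i\in\mathcal N$, for which there is $\{m_1,\dots,m_k\}\in\mathcal M$ with $m_1\leq F_1<m_2\leq F_2<\dots<m_k\leq F_k$. Put $\mathcal S_0=\{\{n\}:n\geq1\}\cup\{\emptyset\}$, $\mathcal S_1=\{F\subset\mathbf N:|F|\leq\min F\}$ (including $\emptyset$) $=\mathcal S_1[\mathcal S_0]$, $\mathcal S_{\alpha+1}=\mathcal S_1[\mathcal S_\alpha]$, and for $\alpha$ a countable limit ordinal choose (and fix) an increasing sequence of ordinals $(\alpha_n)$ with $\alpha=\sup_n\alpha_n$ and let $\mathcal S_\alpha=\bigcup_{n\ge1}\{F\in\mathcal S_{\alpha_n}:n\leq F\}$. Tsirelson spaces. Finite sets $E_1<\dots<E_n$ of integers form an $\mathcal S_\alpha$ admissible sequence if $\{\min E_1,\dots,\min E_n\}\in\mathcal S_\alpha$. On the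 space $c_{00}$ of finitely supported real sequences with unit vector basis $(e_i)$, write $Ex=\sum_{i\in E}a_ie_i$ for $x=\sum a_ie_i$. There is a norm on $c_{00}$ satisfying $\|x\|=\max\bigl(\|x\|_{c_0},\frac12\sup\{\sum_{i=1}^n\|E_ix\|:(E_i)_1^n\text{ is }\mathcal S_\alpha\text{ admissible},\ n\geq1\}\bigr)$; $T(\mathcal S_\alpha,1/2)$ is the completion of $c_{00}$ in this norm. Trees. A tree is a countable, non-empty, partially ordered set $(T,\leq)$ such that for each $x\in T$ the set $\{y\in T:y<x\}$ is linearly ordered and finite. A tree on a set $X$ is such a set $T\subseteq\bigcup_{n\ge1}X^n$ ordered by extension: $(x_1,\dots,x_m)\leq(y_1,\dots,y_n)$ iff $m\leq n$ and $x_i=y_i$ for $i\leq m$. $D(T)=\{x\in T:x<y\text{ for some }y\in T\}$; $T^0=T$, $T^{\alpha+1}=D(T^\alpha)$, $T^\alpha=\bigcap_{\beta<\alpha}T^\beta$ for limit $\alpha$. For $T$ well-founded (no infinite linearly ordered subset), $o(T)=\inf\{\alpha:T^\alpha=\emptyset\}$. Indices. For a Banach space $X$, an $\ell_1$-$K$-tree on $X$ is a tree $T$ on $X$ all of whose nodes consist of norm-one vectors, such that for each $(x_1,\dots,x_m)\in T$ there are $c,C>0$ with $c^{-1}C\leq K$ and $c\sum|a_i|\leq\|\sum a_ix_i\|\leq C\sum|a_i|$ for all real $(a_i)_1^m$. If $X$ has basis $(e_i)$, it is an $\ell_1$-$K$-block basis tree if moreover every node is a block basis of $(e_i)$ (non-zero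 finite linear combinations with successive supports). $I(X,K)$ (resp. $I_b(X,K)$) is the supremum of $o(T)$ over $\ell_1$-$K$-trees (resp. $\ell_1$-$K$-block basis trees) $T$ on $X$; $I(X)=\sup_{1\leq K<\infty}I(X,K)$ and $I_b(X)=\sup_{1\leq K<\infty}I_b(X,K)$. *)

(* Defs.v *)
From HB Require Import structures.
From mathcomp Require Import all_boot all_order all_algebra finmap.
From mathcomp Require Import generic_quotient.
From mathcomp Require Import all_classical all_reals.
From mathcomp Require Import topology normedtype.
Set Implicit Arguments. Unset Strict Implicit. Unset Printing Implicit Defensive.
Import Order.TTheory GRing.Theory Num.Theory.
Import numFieldNormedType.Exports.

Local Open Scope classical_set_scope.
Local Open Scope ring_scope.

(* [cord] is the set omega_1 of all countable ordinals.  Countable ordinals   *)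
(* are presented by Brouwer trees ([BL f] denotes the least upper bound of    *)
(* the arbitrary sequence f), and [cord] is the quotient by mutual [ble], so  *)
(* that equality of ordinals is Leibniz equality.  [cord] is well-ordered   *)
(* ([cord_lt_wf]), has countable initial segments ([cord_countable]), and     *)
(* every sequence in it has a supremum ([cord_sup]).                          *)

Inductive bro : Type := BO | BS of bro | BL of (nat -> bro).

Fixpoint ble (a : bro) : bro -> Prop :=
  match a with
  | BO => fun=> True
  | BS a' => fix lt (b : bro) : Prop :=
      match b with
      | BO => False
      | BS b' => ble a' b'
      | BL g => exists n, lt (g n)
      end
  | BL f => fun b => forall n, ble (f n) b
  end.

Lemma ble_trans a b c : ble a b -> ble b c -> ble a c.
Proof.
elim: a b c => [//|a IHa|f IHf] b c.
  elim: b c => [//|b _|g IHg] c /=.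
    move=> ab; elim: c => [//|c _ /= bc|h IHh /= [n /IHh]].
      exact: IHa ab bc.
    by exists n.
  by move=> [n /IHg abn] gc; apply: abn; apply: gc.
by move=> fb bc n; apply: IHf (fb n) bc.
Qed.

Lemma ble_BL b g n : ble b (g n) -> ble b (BL g).
Proof.
by elim: b => [//|b _ bg|f IHf fg m]; [exists n | apply: IHf; apply: fg].
Qed.

Lemma ble_refl a : ble a a.
Proof. by elim: a => //= f IHf n; apply: (@ble_BL _ _ n). Qed.

Lemma ble_BS a : ble a (BS a).
Proof.
elim: a => //= f IHf n; apply: ble_trans (IHf n) _.
by apply: (@ble_BL _ _ n); apply: ble_refl.
Qed.

Lemma ble_BSW a b : ble (BS a) b -> ble a b.
Proof. exact: (@ble_trans a (BS a) b (ble_BS a)). Qed.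

Lemma ble_total a b : ble a b \/ ble (BS b) a.
Proof.
elim: a b => [|a IHa|f IHf] b; first by left.
  elim: b => [|b _|g IHg]; [by right|exact: IHa|].
  have [[n agn]|nag] := pselect (exists n, ble (BS a) (g n)).
    by left; exists n.
  right=> n; have [agn|//] := IHg n.
  by case: nag; exists n.
have [fb|nfb] := pselect (forall n, ble (f n) b); first by left.
right; move/existsNP: nfb => [n nfb]; exists n.
by have [/nfb|] := IHf n b.
Qed.

Lemma blt_wf : well_founded (fun a b => ble (BS a) b).
Proof.
have H b : forall a, ble (BS a) b -> Acc (fun a b => ble (BS a) b) a.
  elim: b => [|b IHb|g IHg] a /=; first by [].
    by move=> ab; constructor=> c ca; apply: IHb; exact: (@ble_trans (BS c) a b).
  by move=> [n /IHg].
by move=> a; apply: (H (BS a)); apply: ble_refl.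
Qed.

Lemma blt_irr a : ~ ble (BS a) a.
Proof. by elim/(well_founded_ind blt_wf): a => a IH aa; apply: (IH a) => //. Qed.

HB.instance Definition _ := gen_eqMixin bro.
HB.instance Definition _ := gen_choiceMixin bro.

Definition beq : rel bro := fun a b => `[< ble a b /\ ble b a >].

Lemma beq_refl : reflexive beq.
Proof. by move=> a; apply/asboolP; split; apply: ble_refl. Qed.

Lemma beq_sym : symmetric beq.
Proof. by move=> a b; apply/asboolP/asboolP => -[]. Qed.

Lemma beq_trans : transitive beq.
Proof.
move=> b a c /asboolP[ab ba] /asboolP[bc cb]; apply/asboolP.
by split; [apply: ble_trans ab bc|apply: ble_trans cb ba].
Qed.

Canonical beq_equiv := EquivRel beq beq_refl beq_sym beq_trans.

Local Open Scope quotient_scope.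

Definition cord : Type := {eq_quot beq}.
HB.instance Definition _ := Choice.on cord.
HB.instance Definition _ := EqQuotient.on cord.

Definition cle (a b : cord) : bool := `[< ble (repr a) (repr b) >].
Definition clt (a b : cord) : bool := `[< ble (BS (repr a)) (repr b) >].

Lemma clt_def a b : clt a b = ~~ cle b a.
Proof.
apply/idP/idP => [/asboolP ab|nba].
  apply/negP => /asboolP ba.
  by apply: (@blt_irr (repr a)); apply: ble_trans ab ba.
apply/asboolP; have [ba|//] := ble_total (repr b) (repr a).
by case/negP: nba; apply/asboolP.
Qed.

Lemma cle_anti : antisymmetric cle.
Proof.
move=> a b /andP[/asboolP ab /asboolP ba].
by rewrite -[a]reprK -[b]reprK; apply/eqmodP/asboolP.
Qed.

Lemma cle_trans : transitive cle.
Proof.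
move=> b a c /asboolP ab /asboolP bc; apply/asboolP.
exact: ble_trans ab bc.
Qed.

Lemma cle_total : total cle.
Proof.
move=> a b; apply/orP.
have [ab|/ble_BSW ba] := ble_total (repr a) (repr b); [left|right]; exact/asboolP.
Qed.

Lemma clt_order a b : clt a b = (b != a) && cle a b.
Proof.
rewrite clt_def; apply/idP/andP => [nba|[ba ab]].
  split; first by apply: contra nba => /eqP ->; apply/asboolP/ble_refl.
  by case/orP: (cle_total a b) => // ba; rewrite ba in nba.
by apply: contra ba => ba; apply/eqP/cle_anti; rewrite ba.
Qed.

Fact cord_display : Order.disp_t. Proof. exact: Order.default_display. Qed.

Lemma cle_refl : reflexive cle.
Proof. by move=> a; apply/asboolP/ble_refl. Qed.

HB.instance Definition _ := Order.isPOrder.Build cord_display cord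
  clt_order cle_refl cle_anti cle_trans.
HB.instance Definition _ :=
  Order.POrder_isTotal.Build cord_display cord cle_total.

Definition ozero : cord := \pi_cord BO.
Definition osucc (a : cord) : cord := \pi_cord (BS (repr a)).

Lemma cord_leP (a b : cord) : reflect (ble (repr a) (repr b)) (a <= b)%O.
Proof. exact: asboolP. Qed.

Lemma cord_ltP (a b : cord) : reflect (ble (BS (repr a)) (repr b)) (a < b)%O.
Proof. exact: asboolP. Qed.

Lemma repr_pi (x : bro) : ble (repr (\pi_cord x)) x /\ ble x (repr (\pi_cord x)).
Proof. by case: piP => y /eqmodP/asboolP[]. Qed.

Lemma cord_lt_wf : well_founded (fun a b : cord => (a < b)%O).
Proof.
suff H (x : bro) : forall a : cord, repr a = x ->
    Acc (fun a b : cord => (a < b)%O) a by move=> a; exact: (H (repr a)).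
elim/(well_founded_ind blt_wf): x => x IH a ax; constructor=> b /cord_ltP.
by rewrite ax => /IH; apply.
Qed.

Lemma ozero_le (a : cord) : (ozero <= a)%O.
Proof. by apply/cord_leP; apply: (ble_trans (repr_pi BO).1). Qed.

Lemma cord_succ_ltP (a b : cord) : (osucc a <= b)%O = (a < b)%O.
Proof.
apply/cord_leP/cord_ltP => ab.
  exact: ble_trans (repr_pi _).2 ab.
exact: ble_trans (repr_pi _).1 ab.
Qed.

Lemma lt_osucc (a : cord) : (a < osucc a)%O.
Proof. by rewrite -cord_succ_ltP. Qed.

Lemma osucc_inj : injective osucc.
Proof.
have H (a b : cord) : osucc a = osucc b -> (a <= b)%O.
  move=> ab; rewrite leNgt -cord_succ_ltP -ab; apply/negP => /(lt_le_trans (lt_osucc a)).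
  by rewrite ltxx.
by move=> a b ab; apply/le_anti; rewrite !H.
Qed.

Lemma cord_sup (f : nat -> cord) : exists b, supremums (range f) b.
Proof.
exists (\pi_cord (BL (fun n => repr (f n)))); split.
  move=> _ [n _ <-]; apply/cord_leP; apply: ble_trans (repr_pi _).2.
  by apply: (@ble_BL _ _ n); apply: ble_refl.
move=> b fb; apply/cord_leP; apply: (ble_trans (repr_pi _).1) => n.
by apply/cord_leP; apply: fb; exists n.
Qed.

Lemma cord_countable (a : cord) : countable [set b : cord | (b < a)%O].
Proof.
suff H (x : bro) : countable [set b : cord | ble (BS (repr b)) x].
  by rewrite (_ : mkset _ = [set b : cord | ble (BS (repr b)) (repr a)]) //;
    apply/seteqP; split=> b /= /cord_ltP.
elim: x => [|x IHx|f IHf].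
- by rewrite (_ : mkset _ = set0) //; apply/seteqP; split.
- apply: (@sub_countable _ _ _ ([set b : cord | ble (BS (repr b)) x] `|`
    [set \pi_cord x])); last first.
    rewrite -bigcup2E; apply: bigcup_countable => // -[|[|n]] _ /=; first exact: IHx.
      exact: countable1.
    exact: countable0.
  apply: subset_card_le => b /= bx.
  have [xb|] := ble_total x (repr b); last by left.
  right; rewrite -[b]reprK; apply/eqmodP/asboolP; split=> //.
- rewrite (_ : mkset _ = \bigcup_n [set b : cord | ble (BS (repr b)) (f n)]).
    by apply: bigcup_countable.
  by apply/seteqP; split=> b /=; [case=> n; exists n|case=> n _; exists n].
Qed.

(* Transfinite recursion: [z] at 0, [s] at successors; at a limit ordinal a,  *)
(* [l a f], where f agrees below a with the function being defined.           *)
Section Recursion.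
Variables (A : Type) (z : A) (s : A -> A) (l : cord -> (cord -> A) -> A).

Definition ord_rec_step (a : cord) (rec : forall b : cord, (b < a)%O -> A) : A :=
  let f b := if pselect (b < a)%O is left ba then rec b ba else z in
  if a == ozero then z
  else if pselect (exists b, a = osucc b) is left ex then s (f (projT1 (cid ex)))
  else l a f.

Definition ord_rec : cord -> A := Fix cord_lt_wf (fun=> A) ord_rec_step.

Definition is_limit (a : cord) : Prop :=
  a <> ozero /\ ~ exists b, a = osucc b.

Let ord_recE a : ord_rec a = ord_rec_step (fun b (_ : (b < a)%O) => ord_rec b).
Proof.
apply: (@Fix_eq _ _ cord_lt_wf (fun=> A) ord_rec_step) => b f g fg.
by congr ord_rec_step; apply/functional_extensionality_dep => c;
  apply/functional_extensionality_dep.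
Qed.

Lemma ord_rec0 : ord_rec ozero = z.
Proof. by rewrite ord_recE /ord_rec_step eqxx. Qed.

Lemma ord_recS a : ord_rec (osucc a) = s (ord_rec a).
Proof.
rewrite ord_recE /ord_rec_step.
case: eqP => [a0|_]; first by have := ozero_le a; rewrite -a0 leNgt lt_osucc.
case: pselect => [ex|]; last by case; exists a.
case: (cid ex) => b /= ab.
rewrite -(osucc_inj ab).
by case: pselect => //; rewrite lt_osucc.
Qed.

Lemma ord_rec_limit a : is_limit a ->
  ord_rec a = l a (fun b => if (b < a)%O then ord_rec b else z).
Proof.
move=> [a0 aS]; rewrite ord_recE /ord_rec_step.
case: eqP => // _; case: pselect => // _; congr (l a _).
by apply/funext => b; case: pselect => [->//|/negP/negbTE ->].
Qed.

End Recursion.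

Definition oone : cord := osucc ozero.
Definition oomega : cord :=
  supremum ozero (range (fun n : nat => iter n osucc ozero)).

Definition osup_below (a : cord) (f : cord -> cord) : cord :=
  supremum ozero [set f b | b in [set b : cord | (b < a)%O]].

Definition oadd (a : cord) : cord -> cord := ord_rec a osucc osup_below.
Definition omul (a : cord) : cord -> cord :=
  ord_rec ozero (fun c => oadd c a) osup_below.
Definition oexp (a : cord) : cord -> cord :=
  ord_rec oone (fun c => omul c a) osup_below.

(* Ordinals up to and including omega_1.  This is a complete total order, in  *)
(* which the infimum of the empty set is omega_1 and the supremum of the      *)
(* empty set is 0.                                                            *)
Variant xord : Type := Countable_ord of cord | Omega1.

HB.instance Definition _ := gen_eqMixin xord.
HB.instance Definition _ := gen_choiceMixin xord.

Definition xle (a b : xord) : bool :=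
  match a, b with
  | _, Omega1 => true
  | Omega1, Countable_ord _ => false
  | Countable_ord a, Countable_ord b => (a <= b)%O
  end.

Lemma xle_refl : reflexive xle. Proof. by case=> /=. Qed.

Lemma xle_anti : antisymmetric xle.
Proof. by case=> [a|] [b|] //= ab; congr Countable_ord; apply: le_anti. Qed.

Lemma xle_trans : transitive xle.
Proof. by case=> [b|] [a|] [c|] //=; apply: le_trans. Qed.

Lemma xle_total : total xle.
Proof. by case=> [a|] [b|] //=; apply: le_total. Qed.

HB.instance Definition _ := Order.Le_isPOrder.Build cord_display xord
  xle_refl xle_anti xle_trans.
HB.instance Definition _ :=
  Order.POrder_isTotal.Build cord_display xord xle_total.

Definition xsup (A : set xord) : xord := supremum (Countable_ord ozero) A.
Definition xinf (A : set xord) : xord := infimum Omega1 A.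

(* Finite sets of positive integers are elements of {fset nat}; no member of  *)
(* the Schreier families below contains 0.                                    *)

Definition fset_lt (E F : {fset nat}) : bool := allrel ltn E F.
Definition nat_le_fset (n : nat) (F : {fset nat}) : bool := all (leq n) F.
Definition fset_lt_nat (F : {fset nat}) (n : nat) : bool := all (ltn^~ n) F.
Definition fset_min (E : {fset nat}) : nat := head 0%N (sort leq E).

(* M[N].  Strict monotonicity of m, automatic when all F i are non-empty, is  *)
(* required because empty F i compare vacuously.                              *)
Definition convolution (M N : set {fset nat}) : set {fset nat} :=
  [set G | exists (k : nat) (m : nat -> nat) (F : nat -> {fset nat}),
    [/\ (0 < k)%N, M [fset m i | i in iota 0 k]%fset,
        forall i, (i < k)%N -> N (F i) /\ nat_le_fset (m i) (F i),
        forall i, (i.+1 < k)%N -> fset_lt_nat (F i) (m i.+1) /\ (m i < m i.+1)%N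
      & G = (\bigcup_(i <- iota 0 k) F i)%fset]].

Definition schreier0 : set {fset nat} :=
  [set F | F = fset0 \/ exists2 n, (1 <= n)%N & F = [fset n]%fset].
Definition schreier1 : set {fset nat} :=
  [set F : {fset nat} | nat_le_fset #|` F|%fset F].

(* fs a n is the (n+1)-st term of the sequence chosen for the limit a.        *)
Definition fundamental_sequences (fs : cord -> nat -> cord) : Prop :=
  forall a, is_limit a ->
    (forall n, (fs a n < fs a n.+1)%O) /\ supremums (range (fs a)) a.

Definition schreier (fs : cord -> nat -> cord) : cord -> set {fset nat} :=
  ord_rec schreier0 (convolution schreier1)
    (fun a S => [set F | exists n : nat, S (fs a n) F /\ nat_le_fset n.+1 F]).

Lemma schreier_0 fs : schreier fs ozero = schreier0.
Proof. exact: ord_rec0. Qed.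

Lemma schreier_succ fs a :
  schreier fs (osucc a) = convolution schreier1 (schreier fs a).
Proof. exact: ord_recS. Qed.

Lemma schreier_limit fs a : fundamental_sequences fs -> is_limit a ->
  schreier fs a =
  [set F | exists n : nat, schreier fs (fs a n) F /\ nat_le_fset n.+1 F].
Proof.
move=> hfs la; rewrite [LHS]ord_rec_limit//.
have lt_fs n : (fs a n < a)%O.
  have [inc [ub _]] := hfs _ la.
  by apply: lt_le_trans (inc n) _; apply: ub; exists n.+1.
by apply/seteqP; split=> F [n]; rewrite ?lt_fs => nF; exists n; rewrite ?lt_fs.
Qed.

Definition admissible (S : set {fset nat}) (E : seq {fset nat}) : Prop :=
  [/\ E != [::], fset0 \notin E, pairwise fset_lt E
    & S [fset fset_min F | F in E]%fset].

(* c_00.  The basis of the space is indexed by the positive integers: the     *)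
(* k-th coordinate of a vector is its coefficient on e_{k+1}.                 *)
Section C00.
Variable R : realType.

Definition finite_support : {pred nat -> R} :=
  [pred x | `[< finite_set [set i | x i != 0] >]].

Lemma finite_support_submod_closed : submod_closed finite_support.
Proof.
split=> [|a x y].
  apply/asboolP; rewrite (_ : mkset _ = set0); first exact: finite_set0.
  by apply/seteqP; split=> i //=; rewrite eqxx.
move=> /asboolP fx /asboolP fy; apply/asboolP.
apply: (@sub_finite_set _ _ ([set i | x i != 0] `|` [set i | y i != 0])).
  move=> i /= h; apply/orP; apply: contraNT h; rewrite negb_or !negbK.
  by move=> /andP[/eqP xi /eqP yi]; rewrite -[(_ + _) i]/(a * x i + y i) xi yi mulr0 addr0.
by rewrite finite_setU.
Qed.

HB.instance Definition _ := GRing.isSubmodClosed.Build R (nat -> R)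
  finite_support finite_support_submod_closed.

Record c00 : Type := C00 { c00_val :> nat -> R; _ : c00_val \in finite_support }.

HB.instance Definition _ := [isSub for c00_val].
HB.instance Definition _ := [Choice of c00 by <:].
HB.instance Definition _ := [SubChoice_isSubLmodule of c00 by <:].

Fact c00_restr_subproof (E : {fset nat}) (x : c00) :
  (fun k => if k.+1 \in E then x k else 0) \in finite_support.
Proof.
apply/asboolP; case: x => x /= /asboolP; apply: sub_finite_set => k /=.
by case: ifP => //; rewrite eqxx.
Qed.

Definition c00_restr (E : {fset nat}) (x : c00) : c00 :=
  C00 (c00_restr_subproof E x).

Fact c00_unit_subproof (k : nat) :
  (fun i => (i == k)%:R : R) \in finite_support.
Proof.
apply/asboolP; apply: (@sub_finite_set _ _ [set k]); last exact: finite_set1.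
by move=> i /=; have [//|_] := eqVneq i k; rewrite eqxx.
Qed.

Definition c00_unit (k : nat) : c00 := C00 (c00_unit_subproof k).

Definition sup_norm (x : c00) : R := sup (range (fun k => `|x k|)).

Definition is_norm (N : c00 -> R) : Prop :=
  [/\ forall x, N x = 0 -> x = 0,
      forall (a : R) x, N (a *: x) = `|a| * N x
    & forall x y, N (x + y) <= N x + N y].

Definition tsirelson_norm (S : set {fset nat}) (theta : R) (N : c00 -> R) : Prop :=
  is_norm N /\
  forall x, N x = Num.max (sup_norm x)
    (theta * sup [set \sum_(F <- E) N (c00_restr F x) | E in admissible S]).

(* X, with iota, is the completion of (c_00, N).                              *)
Definition is_completion (N : c00 -> R) (X : completeNormedModType R)
    (iota : {linear c00 -> X}) : Prop :=
  (forall x, `|iota x| = N x) /\ closure (range iota) = setT.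

End C00.

(* Trees on a set X: sets of non-empty finite sequences, ordered by           *)
(* extension; they need not be closed under initial segments.  The            *)
(* predecessors of a node are among its finitely many prefixes, which are     *)
(* linearly ordered, so no condition on them is needed.                       *)
Section Trees.
Variable X : eqType.
Implicit Type T : set (seq X).

Definition is_tree T : Prop := [/\ T !=set0, countable T & ~ T [::]].

Definition extends (s t : seq X) : bool := prefix s t && (s != t).

Definition derived_tree T : set (seq X) :=
  [set s | T s /\ exists2 t, T t & extends s t].

Definition derived_tree_iter T : cord -> set (seq X) :=
  ord_rec T derived_tree
    (fun a D => [set s | forall b : cord, (b < a)%O -> D b s]).

Lemma derived_tree_iter0 T : derived_tree_iter T ozero = T.
Proof. exact: ord_rec0. Qed.

Lemma derived_tree_iterS T a :
  derived_tree_iter T (osucc a) = derived_tree (derived_tree_iter T a).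
Proof. exact: ord_recS. Qed.

Lemma derived_tree_iter_limit T a : is_limit a ->
  derived_tree_iter T a =
  \bigcap_(b in [set b : cord | (b < a)%O]) derived_tree_iter T b.
Proof.
move=> la; rewrite [LHS]ord_rec_limit//.
by apply/seteqP; split=> s sT b /= ba; have := sT b ba; rewrite ba.
Qed.

(* o(T); it is omega_1 when T is not well-founded.                            *)
Definition tree_order T : xord :=
  xinf [set Countable_ord a | a in [set a | derived_tree_iter T a = set0]].

End Trees.

Section Indices.
Variables (R : realType) (X : normedModType R).

Definition l1_tree (K : R) (T : set (seq X)) : Prop :=
  is_tree T /\
  forall s, T s ->
    (forall x, x \in s -> `|x| = 1) /\
    exists c C : R, [/\ 0 < c, 0 < C, c^-1 * C <= K
      & forall a : 'I_(size s) -> R,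
          c * (\sum_i `|a i|) <= `|\sum_i a i *: s`_i| <= C * (\sum_i `|a i|)].

(* s is a block basis of e; F j is the support of the j-th vector.            *)
Definition block_basis (e : nat -> X) (s : seq X) : Prop :=
  exists (F : nat -> {fset nat}) (c : nat -> nat -> R),
    (forall j, (j < size s)%N ->
      [/\ F j != fset0, forall i, i \in F j -> c j i != 0
        & s`_j = \sum_(i <- F j) c j i *: e i]) /\
    (forall j, (j.+1 < size s)%N -> fset_lt (F j) (F j.+1)).

Definition l1_block_tree (e : nat -> X) (K : R) (T : set (seq X)) : Prop :=
  l1_tree K T /\ forall s, T s -> block_basis e s.

Definition l1_index_const (K : R) : xord :=
  xsup [set @tree_order X T | T in l1_tree K].
Definition l1_block_index_const (e : nat -> X) (K : R) : xord :=
  xsup [set @tree_order X T | T in l1_block_tree e K].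

Definition l1_index : xord :=
  xsup [set l1_index_const K | K in [set K : R | 1 <= K]].
Definition l1_block_index (e : nat -> X) : xord :=
  xsup [set l1_block_index_const e K | K in [set K : R | 1 <= K]].

End Indices.
Arguments l1_index {R} X.

(* Main.v *)
Require Import Defs.
From HB Require Import structures.
From mathcomp Require Import all_boot all_order all_algebra finmap.
From mathcomp Require Import all_classical all_reals.
From mathcomp Require Import topology normedtype.
From mathcomp Require Import lra ring.
Set Implicit Arguments. Unset Strict Implicit. Unset Printing Implicit Defensive.
Import Order.TTheory GRing.Theory Num.Theory.
Import numFieldNormedType.Exports.
Local Open Scope classical_set_scope.
Local Open Scope ring_scope.

(** Write S for S_alpha, N for the norm of T(S, 1/2), and S^k for the k-fold
convolution S[S[..[S_0]]], where S_0 consists of the singletons and the empty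
set.  Both inequalities compare l_1-trees with the families S^k.

Lower bound.  Unfolding the norm equation k times gives
N x >= 2 ^ - k sum_(i in F) |x_i| for every F in S^k ([tnorm_convolution_power]),
so the branches (e_i), i in F, F in S^k, form an l_1-block basis tree with
constant 2 ^ k.  Ranks multiply under convolution ([labelled_rank]); hence S_a
has rank at least omega ^ a, the family S^k at least omega ^ (alpha k), and the supremum
over k is omega ^ (alpha omega).

Upper bound.  Call a family G of finite sets small of exponent xi if every tree
of finite sets of rank omega ^ xi, in which next entries can be taken as large as
desired, has a branch that carries a probability vector giving mass at most
epsilon to all members of G.  Smallness passes through the
construction of the families: if the members of G meeting an initial segment
are small of exponent xi then G is small of exponent xi + 1 ([small_succ]), so S_a is
small of exponent a + 1; and if M, G are small of exponents mu, xi then M[G] is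
small of exponent xi + mu, by averaging over averages ([small_labelled]).
Therefore each S^k is small of an exponent below alpha omega.

On the other hand, let z_1 < z_2 < .. be blocks of norm at most B and let a_j be
nonnegative weights of total mass 1.  In an admissible sequence E, the blocks that
meet at least two sets of E form, when identified with the ends of their
supports, a member of S; each other block is treated inside a single set of E and
gains the factor 1/2.  Iterating, N (sum a_j z_j) <= B (2 ^ - k + k a(G)) for some G in
S^k ([tnorm_blocks]).

Finally let T be an l_1-K-tree on T(S, 1/2) of order above omega ^ (alpha omega).
Among d + 1 vectors of a branch some l_1-normalized combination vanishes on
the first d coordinates, up to a small perturbation in c_00.  In this way T yields
a tree, still of rank omega ^ xi for every xi < alpha omega, of blocks with an
l_1-lower estimate of constant 1 / (2 K) ([l1_blocks_rank]).  Smallness of S^k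
gives weights for which the previous estimate contradicts this lower bound as soon
as k is large. *)

(** * Countable ordinals *)

Lemma cord_min (P : cord -> Prop) : (exists a, P a) ->
  exists a, P a /\ forall b, P b -> (a <= b)%O.
Proof.
move=> [a Pa]; apply: contrapT => nP; move: Pa.
elim/(well_founded_ind cord_lt_wf): a => a IH Pa; apply: nP; exists a; split=> // b Pb.
by rewrite leNgt; apply/negP => /IH /(_ Pb).
Qed.

(** In a general partial order [supremum] is meaningful only when a supremum
exists. *)
Lemma supremum_lub d (T : porderType d) (x0 : T) (A : set T) :
  A !=set0 -> (exists s, supremums A s) -> supremums A (supremum x0 A).
Proof.
move=> /set0P A0 [s As]; rewrite /supremum (negbTE A0).
by case: xgetP => [y -> //|/(_ s)].
Qed.

(** An initial segment of the countable ordinals is countable, so the family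
f b, b < a, can be listed in a sequence, to which [cord_sup] applies. *)
Lemma osup_belowP (a : cord) (f : cord -> cord) : (ozero < a)%O ->
  forall u, (osup_below a f <= u)%O <-> (forall b, (b < a)%O -> (f b <= u)%O).
Proof.
move=> a0.
have /countable_injP[g ging] := cord_countable a.
pose h n := if pselect (exists b, (b < a)%O /\ g b = n) is left e
            then f (projT1 (cid e)) else ozero.
have [s [sub _]] := cord_sup h.
have [t [tub tmin]] : exists t, (forall b, (b < a)%O -> (f b <= t)%O) /\
    forall u, (forall b, (b < a)%O -> (f b <= u)%O) -> (t <= u)%O.
  apply: cord_min; exists s => b ba; apply: sub; exists (g b) => //.
  rewrite /h; case: pselect => [e|]; last by case; exists b.
  case: (cid e) => c /= [ca /ging ->] //; exact: mem_set.
have [] := @supremum_lub _ _ ozero [set f b | b in [set b : cord | (b < a)%O]].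
- by exists (f ozero); exists ozero.
- exists t; split=> [_ [b ba <-]|u uub]; first exact: tub.
  by apply: tmin => b ba; apply: uub; exists b.
rewrite -/(osup_below a f) => sub1 smin u; split=> [su b ba|fu].
  by apply: le_trans su; apply: sub1; exists b.
by apply: smin => _ [b ba <-]; apply: fu.
Qed.

Lemma limit_gt0 l : is_limit l -> (ozero < l)%O.
Proof. by move=> [l0 _]; rewrite lt_neqAle ozero_le eq_sym andbT; apply/eqP. Qed.

Lemma limit_succ_lt l b : is_limit l -> (b < l)%O -> (osucc b < l)%O.
Proof.
move=> [_ lS] bl; rewrite lt_neqAle cord_succ_ltP bl andbT.
by apply/eqP => bE; apply: lS; exists b.
Qed.

Lemma lt_osuccE (a b : cord) : (a < osucc b)%O = (a <= b)%O.
Proof. by rewrite ltNge cord_succ_ltP -leNgt. Qed.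

Lemma le_osucc2 (a b : cord) : (osucc a <= osucc b)%O = (a <= b)%O.
Proof. by rewrite cord_succ_ltP lt_osuccE. Qed.

Lemma cord_ind (P : cord -> Prop) : P ozero -> (forall a, P a -> P (osucc a)) ->
  (forall l, is_limit l -> (forall b, (b < l)%O -> P b) -> P l) -> forall a, P a.
Proof.
move=> P0 PS PL; elim/(well_founded_ind cord_lt_wf) => a IH.
have [->//|a0] := eqVneq a ozero.
have [[b ab]|nS] := pselect (exists b, a = osucc b).
  by rewrite ab; apply: PS; apply: IH; rewrite ab lt_osucc.
by apply: PL => //; split=> //; apply/eqP.
Qed.

(** Stating the supremum as a Galois connection makes composition and equality
of continuous functions one-line arguments, without witnesses of suprema. *)
Definition continuous_ord (f : cord -> cord) := forall l, is_limit l ->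
  forall u, (f l <= u)%O <-> (forall b, (b < l)%O -> (f b <= u)%O).

Lemma ord_rec_continuous z s : continuous_ord (ord_rec z s osup_below).
Proof.
move=> l ll u; rewrite ord_rec_limit// osup_belowP; last exact: limit_gt0.
by split=> h b bl; have := h b bl; rewrite bl.
Qed.

Lemma continuous_lt f l u : continuous_ord f -> is_limit l -> (u < f l)%O ->
  exists2 b, (b < l)%O & (u < f b)%O.
Proof.
move=> cf ll ul; apply: contrapT => nb.
suff : (f l <= u)%O by rewrite leNgt ul.
by apply/cf => // b bl; rewrite leNgt; apply/negP => ub; apply: nb; exists b.
Qed.

Lemma continuous_le_limit f l b : continuous_ord f -> is_limit l -> (b < l)%O ->
  (f b <= f l)%O.
Proof. by move=> cf ll; apply: (cf l ll (f l)).1. Qed.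

Lemma continuous_nondecreasing f : continuous_ord f ->
  (forall b, f b <= f (osucc b))%O -> forall b c, (b <= c)%O -> (f b <= f c)%O.
Proof.
move=> cf fS b; elim/cord_ind => [|c IH|l ll IH].
- by move=> b0; rewrite (le_anti (introT andP (conj b0 (ozero_le b)))).
- rewrite le_eqVlt => /orP[/eqP->//|]; rewrite lt_osuccE => /IH /le_trans; apply.
  exact: fS.
- by rewrite le_eqVlt => /orP[/eqP->//|/(continuous_le_limit cf ll)].
Qed.

Lemma continuous_increasing f : continuous_ord f ->
  (forall b, f b < f (osucc b))%O -> forall b c, (b < c)%O -> (f b < f c)%O.
Proof.
move=> cf fS b c bc; apply: lt_le_trans (fS b) _.
apply: (continuous_nondecreasing cf); last by rewrite cord_succ_ltP.
by move=> d; apply: ltW.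
Qed.

Section Comp.
Variables f g : cord -> cord.
Hypotheses (cf : continuous_ord f) (cg : continuous_ord g).
Hypothesis incg : forall b c, (b < c)%O -> (g b < g c)%O.

Lemma increasing_limit l : is_limit l -> is_limit (g l).
Proof.
move=> ll; split=> [g0|[c gc]].
  by have := incg (limit_gt0 ll); rewrite g0 ltNge ozero_le.
have : (c < g l)%O by rewrite gc lt_osucc.
move=> /(continuous_lt cg ll)[b bl]; rewrite -cord_succ_ltP -gc => glb.
by have := incg bl; rewrite ltNge glb.
Qed.

Lemma continuous_comp : (forall b c, (b <= c)%O -> (f b <= f c)%O) ->
  continuous_ord (f \o g).
Proof.
move=> ndf l ll u; rewrite /=; split=> [fu b bl|fu].
  by apply: le_trans fu; apply/ndf/ltW/incg.
apply/(cf (increasing_limit ll)) => d /(continuous_lt cg ll)[b bl db].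
exact: le_trans (ndf _ _ (ltW db)) (fu b bl).
Qed.

End Comp.

Lemma continuous_eq f g : continuous_ord f -> continuous_ord g ->
  f ozero = g ozero -> (forall b, f b = g b -> f (osucc b) = g (osucc b)) ->
  f =1 g.
Proof.
move=> cf cg fg0 fgS; elim/cord_ind => [//|b /fgS//|l ll IH].
apply/le_anti/andP; split; [apply/(cf l ll)|apply/(cg l ll)] => b bl.
  by rewrite IH//; apply: continuous_le_limit.
by rewrite -IH//; apply: continuous_le_limit.
Qed.

(** ** Addition *)

Lemma oadd0 a : oadd a ozero = a. Proof. exact: ord_rec0. Qed.
Lemma oaddS a b : oadd a (osucc b) = osucc (oadd a b).
Proof. exact: ord_recS. Qed.
Lemma oadd_continuous a : continuous_ord (oadd a).
Proof. exact: ord_rec_continuous. Qed.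

Lemma oadd_lt a b c : (b < c)%O -> (oadd a b < oadd a c)%O.
Proof.
apply: (continuous_increasing (oadd_continuous a)) => d.
by rewrite oaddS lt_osucc.
Qed.

Lemma oadd_le a b c : (b <= c)%O -> (oadd a b <= oadd a c)%O.
Proof. by rewrite le_eqVlt => /orP[/eqP->//|/oadd_lt/ltW]. Qed.

Lemma oadd_leW a b : (a <= oadd a b)%O.
Proof. by rewrite -{1}(oadd0 a); apply/oadd_le/ozero_le. Qed.

Lemma oaddA a b c : oadd a (oadd b c) = oadd (oadd a b) c.
Proof.
move: c; apply: continuous_eq => [|||c /= IH].
- by apply: continuous_comp; [exact: oadd_continuous|exact: oadd_continuous
    |exact: oadd_lt|exact: oadd_le].
- exact: oadd_continuous.
- by rewrite !oadd0.
- by rewrite !oaddS IH.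
Qed.

Lemma lt_oadd a b c : (c < oadd a b)%O ->
  (c < a)%O \/ exists2 d, (d < b)%O & (c <= oadd a d)%O.
Proof.
elim/cord_ind: b => [|b _|l ll _].
- by rewrite oadd0; left.
- by rewrite oaddS lt_osuccE => cb; right; exists b => //; exact: lt_osucc.
- move=> /(continuous_lt (oadd_continuous a) ll)[d dl /ltW cd].
  by right; exists d.
Qed.

Lemma oadd_leL a b c : (a <= b)%O -> (oadd a c <= oadd b c)%O.
Proof.
move=> ab; elim/cord_ind: c => [|c IH|l ll IH].
- by rewrite !oadd0.
- by rewrite !oaddS le_osucc2.
- apply/(oadd_continuous _ ll) => c cl.
  exact: le_trans (IH c cl) (oadd_le b (ltW cl)).
Qed.

(** ** Multiplication *)

Lemma omul0 a : omul a ozero = ozero. Proof. exact: ord_rec0. Qed.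
Lemma omulS a b : omul a (osucc b) = oadd (omul a b) a.
Proof. exact: ord_recS. Qed.
Lemma omul_continuous a : continuous_ord (omul a).
Proof. exact: ord_rec_continuous. Qed.

Lemma omul_le a b c : (b <= c)%O -> (omul a b <= omul a c)%O.
Proof.
apply: (continuous_nondecreasing (omul_continuous a)) => d.
by rewrite omulS oadd_leW.
Qed.

Lemma omul_lt a b c : (ozero < a)%O -> (b < c)%O -> (omul a b < omul a c)%O.
Proof.
move=> a0; apply: (continuous_increasing (omul_continuous a)) => d.
by rewrite omulS -{1}(oadd0 (omul a d)) oadd_lt.
Qed.

Lemma omulDr a b c : omul a (oadd b c) = oadd (omul a b) (omul a c).
Proof.
have [->|a0] := eqVneq a ozero.
  have m0 d : omul ozero d = ozero.
    move: d; apply: continuous_eq => [||//|d].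
    - exact: omul_continuous.
    - by move=> l ll u; split=> // _ *; apply: ozero_le.
    - exact: omul0.
    - by rewrite omulS oadd0.
  by rewrite !m0 oadd0.
have a1 : (ozero < a)%O by rewrite lt_neqAle ozero_le eq_sym a0.
move: c; apply: continuous_eq => [|||c /= IH].
- apply: continuous_comp; [exact: omul_continuous|exact: oadd_continuous| |].
  + exact: oadd_lt.
  + exact: omul_le.
- apply: continuous_comp; [exact: oadd_continuous|exact: omul_continuous| |].
  + by move=> ? ?; apply: omul_lt.
  + exact: oadd_le.
- by rewrite /= omul0 !oadd0.
- by rewrite oaddS !omulS IH oaddA.
Qed.

Lemma omulA a b c : (ozero < b)%O -> omul a (omul b c) = omul (omul a b) c.
Proof.
move=> b0; move: c; apply: continuous_eq => [|||c /= IH].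
- apply: continuous_comp; [exact: omul_continuous|exact: omul_continuous| |].
  + by move=> ? ?; apply: omul_lt.
  + exact: omul_le.
- exact: omul_continuous.
- by rewrite /= !omul0.
- by rewrite !omulS omulDr IH.
Qed.

Lemma lt_omul a b c : (c < omul a b)%O ->
  exists2 d, (d < b)%O & (c < oadd (omul a d) a)%O.
Proof.
elim/cord_ind: b => [|b _|l ll IH].
- by rewrite omul0 ltNge ozero_le.
- by rewrite omulS => cb; exists b => //; exact: lt_osucc.
- move=> /(continuous_lt (omul_continuous a) ll)[d dl /(IH d dl)[e ed ce]].
  by exists e => //; apply: lt_trans dl.
Qed.

(** ** Finite ordinals and omega *)

Definition ofin (n : nat) : cord := iter n osucc ozero.

Lemma oomega_lub : supremums (range ofin) oomega.
Proof. by apply: supremum_lub; [exists ozero, 0%N|exact: cord_sup]. Qed.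

Lemma ofin_lt_omega n : (ofin n < oomega)%O.
Proof.
apply: lt_le_trans (lt_osucc _) _.
by have [ub _] := oomega_lub; apply: ub; exists n.+1.
Qed.

Lemma lt_omega b : (b < oomega)%O -> exists n, b = ofin n.
Proof.
move=> bo; have [n bn] : exists n, (b <= ofin n)%O.
  apply: contrapT => nb; have [_ lub] := oomega_lub.
  suff : (oomega <= b)%O by rewrite leNgt bo.
  apply: lub => _ [n _ <-]; rewrite leNgt; apply/negP => /ltW bn.
  by apply: nb; exists n.
elim: n bn => [|n IH].
  by move=> b0; exists 0%N; apply/le_anti; rewrite b0 ozero_le.
rewrite le_eqVlt => /orP[/eqP->|]; first by exists n.+1.
by rewrite lt_osuccE => /IH.
Qed.

Lemma omega_limit : is_limit oomega.
Proof.
split=> [o0|[b bE]]; first by have := ofin_lt_omega 0; rewrite o0 ltxx.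
have : (b < oomega)%O by rewrite bE lt_osucc.
move=> /lt_omega[n bn]; have := ofin_lt_omega n.+1.
by rewrite bE bn ltxx.
Qed.

Lemma omega_gt0 : (ozero < oomega)%O. Proof. exact: limit_gt0 omega_limit. Qed.

Lemma omul1 a : omul a oone = a.
Proof.
rewrite /oone omulS omul0; move: a; apply: continuous_eq => //.
- exact: oadd_continuous.
- by move=> l ll u; split=> [lu b /ltW /le_trans|h]; [apply|
    rewrite leNgt; apply/negP => ul; have /h := limit_succ_lt ll ul;
    rewrite cord_succ_ltP ltxx].
- exact: oadd0.
- by move=> b; rewrite oaddS => ->.
Qed.

Lemma oone_add a : (oadd oone a <= osucc a)%O.
Proof.
elim/cord_ind: a => [|a IH|l ll IH].
- by rewrite oadd0.
- by rewrite oaddS le_osucc2.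
- apply/(oadd_continuous _ ll) => b bl.
  exact: le_trans (IH b bl) (ltW (lt_trans (limit_succ_lt ll bl) (lt_osucc l))).
Qed.

(** ** Powers of omega *)

Definition omegapow := oexp oomega.

Lemma omegapow0 : omegapow ozero = oone. Proof. exact: ord_rec0. Qed.
Lemma omegapowS a : omegapow (osucc a) = omul (omegapow a) oomega.
Proof. exact: ord_recS. Qed.
Lemma omegapow_continuous : continuous_ord omegapow.
Proof. exact: ord_rec_continuous. Qed.

Lemma omegapow_gt0 a : (ozero < omegapow a)%O.
Proof.
elim/cord_ind: a => [|a IH|l ll IH].
- by rewrite omegapow0 lt_osucc.
- by rewrite omegapowS -(omul0 (omegapow a)); apply/omul_lt/omega_gt0.
- apply: lt_le_trans (IH _ (limit_gt0 ll)) _.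
  exact: continuous_le_limit omegapow_continuous ll (limit_gt0 ll).
Qed.

Lemma omegapow_lt a b : (a < b)%O -> (omegapow a < omegapow b)%O.
Proof.
apply: (continuous_increasing omegapow_continuous) => c.
rewrite omegapowS -{1}(omul1 (omegapow c)).
exact: omul_lt (omegapow_gt0 c) (ofin_lt_omega 1).
Qed.

Lemma omegapow_le a b : (a <= b)%O -> (omegapow a <= omegapow b)%O.
Proof. by rewrite le_eqVlt => /orP[/eqP->//|/omegapow_lt/ltW]. Qed.

Lemma omegapowD a b : omegapow (oadd a b) = omul (omegapow a) (omegapow b).
Proof.
move: b; apply: continuous_eq => [|||b /= IH].
- apply: continuous_comp; [exact: omegapow_continuous|exact: oadd_continuous| |].
  + exact: oadd_lt.
  + exact: omegapow_le.
- apply: continuous_comp; [exact: omul_continuous|exact: omegapow_continuous| |].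
  + exact: omegapow_lt.
  + exact: omul_le.
- by rewrite /= oadd0 omegapow0 omul1.
- by rewrite oaddS !omegapowS IH omulA// omegapow_gt0.
Qed.

Lemma omul_one a : omul oone a = a.
Proof.
move: a; apply: continuous_eq => //.
- exact: omul_continuous.
- by move=> l ll u; split=> [lu b /ltW /le_trans|h]; [apply|
    rewrite leNgt; apply/negP => ul; have /h := limit_succ_lt ll ul;
    rewrite cord_succ_ltP ltxx].
- exact: omul0.
- by move=> b; rewrite omulS => ->; rewrite /oone oaddS oadd0.
Qed.

Lemma omegapow1 : omegapow oone = oomega.
Proof. by rewrite /oone omegapowS omegapow0 omul_one. Qed.

(** The tree of block vectors extracted from a tree of arbitrary vectors loses
a left factor omega; since 1 + a <= a + 1 this costs at most one in the
exponent. *)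
Lemma omega_mul_omegapow a :
  (omul oomega (omegapow a) <= omegapow (osucc a))%O.
Proof.
rewrite -{1}omegapow1 -omegapowD; apply: omegapow_le; exact: oone_add.
Qed.

(** Only the closure of alpha omega under the addition of alpha + 1 is needed
from the arithmetic of exponents. *)
Section AlphaOmega.
Variable alpha : cord.
Hypothesis alpha1 : (oone <= alpha)%O.

Let alpha0 : (ozero < alpha)%O.
Proof. by apply: lt_le_trans alpha1; exact: lt_osucc. Qed.

Lemma omul_omega_limit : is_limit (omul alpha oomega).
Proof.
apply: increasing_limit omega_limit; first exact: omul_continuous.
by move=> ? ?; apply: omul_lt.
Qed.

Lemma omul_omega_add_lt x : (x < omul alpha oomega)%O ->
  (oadd x (osucc alpha) < omul alpha oomega)%O.
Proof.
move=> /(continuous_lt (@omul_continuous _) omega_limit)[_ /lt_omega[n ->]] xn.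
rewrite oaddS; apply: (limit_succ_lt omul_omega_limit).
apply: le_lt_trans (oadd_leL alpha (ltW xn)) _.
by rewrite -omulS -[osucc _]/(ofin n.+1); apply/omul_lt/ofin_lt_omega.
Qed.

Lemma omegapow_omul_omega_lub u : (forall n, omegapow (omul alpha (ofin n)) <= u)%O ->
  (omegapow (omul alpha oomega) <= u)%O.
Proof.
move=> h; apply/(omegapow_continuous omul_omega_limit) => b.
move=> /(continuous_lt (@omul_continuous _) omega_limit)[_ /lt_omega[n ->]] bn.
exact: le_trans (omegapow_le (ltW bn)) (h n).
Qed.

End AlphaOmega.

(** ** Suprema and infima of ordinals at most omega_1 *)

Lemma xord_min (A : set xord) : A !=set0 -> exists2 a, A a & lbound A a.
Proof.
move=> [a Aa].
have [[b Ab]|nb] := pselect (exists b, A (Countable_ord b)).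
  have [c [Ac cmin]] :=
    @cord_min (fun c => A (Countable_ord c)) (ex_intro _ b Ab).
  by exists (Countable_ord c) => // -[d /cmin|].
exists Omega1; first by case: a Aa => // b Ab; case: nb; exists b.
by case=> // b Ab; case: nb; exists b.
Qed.

Lemma xsup_lub (A : set xord) : supremums A (xsup A).
Proof.
have [->|/set0P A0] := eqVneq A set0.
  rewrite /xsup supremum0; split=> [//|[b|] _ //]; exact: ozero_le.
apply: supremum_lub => //.
have [s As smin] : exists2 s, ubound A s & lbound (ubound A) s.
  by apply: xord_min; exists Omega1 => -[].
by exists s.
Qed.

Lemma xinf_glb (A : set xord) u : lbound A u -> (u <= xinf A)%O.
Proof.
move=> uA; have [->|/set0P A0] := eqVneq A set0.
  by rewrite /xinf /infimum eqxx; case: u uA.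
rewrite /xinf /infimum (negbTE ((set0P A).2 A0)).
have [s As smin] := xord_min A0.
have sinf : infimums A s by split=> // v; apply.
by case: xgetP => [y -> [_ /(_ u)]|/(_ s)]; [apply|].
Qed.

Lemma xinf_le (A : set xord) a : A a -> (xinf A <= a)%O.
Proof.
move=> Aa; have A0 : A !=set0 by exists a.
rewrite /xinf /infimum (negbTE ((set0P A).2 A0)).
have [s As smin] := xord_min A0.
have sinf : infimums A s by split=> // v; apply.
by case: xgetP => [y -> [lb _]|/(_ s)]; [apply: lb|].
Qed.

(** * Ranks of nodes *)

(** The rank of a node in a prefix-closed tree P, defined from above so that it
makes sense for all P.  The condition C n y on the next entry is trivial for trees of
vectors, and expresses y > n for trees of integers. *)
Inductive rank_ge (Y : Type) (C : nat -> Y -> Prop) (P : seq Y -> Prop) :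
  cord -> seq Y -> Prop :=
| RankGe g s : P s ->
    (forall b n, (b < g)%O -> exists y, C n y /\ rank_ge C P b (rcons s y)) ->
    rank_ge C P g s.

Section Rank.
Variables (Y : Type) (C : nat -> Y -> Prop).
Implicit Types (P Q : seq Y -> Prop) (s t : seq Y) (g b : cord).

Lemma rank_ge_here P g s : rank_ge C P g s -> P s.
Proof. by case. Qed.

Lemma rank_ge_next P g s b n : rank_ge C P g s -> (b < g)%O ->
  exists y, C n y /\ rank_ge C P b (rcons s y).
Proof. by case=> {}g {}s _; apply. Qed.

Lemma rank_ge_le P g b s : (b <= g)%O -> rank_ge C P g s -> rank_ge C P b s.
Proof.
move=> bg Pg; constructor; first exact: rank_ge_here Pg.
by move=> c n cb; apply: (rank_ge_next n Pg); apply: lt_le_trans bg.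
Qed.

Lemma rank_ge_sub P Q g s : (forall t, P (s ++ t) -> Q (s ++ t)) ->
  rank_ge C P g s -> rank_ge C Q g s.
Proof.
elim/(well_founded_ind cord_lt_wf): g s => g IH s PQ Pg; constructor.
  by have := PQ [::]; rewrite cats0; apply; apply: rank_ge_here Pg.
move=> b n bg; have [y [Cy Py]] := rank_ge_next n Pg bg.
exists y; split=> //; apply: IH => // t; rewrite cat_rcons; exact: PQ.
Qed.

Lemma rank_ge_shift P g s t :
  rank_ge C P g (s ++ t) -> rank_ge C (fun u => P (s ++ u)) g t.
Proof.
elim/(well_founded_ind cord_lt_wf): g t => g IH t Pg; constructor.
  exact: rank_ge_here Pg.
move=> b n bg; have [y [Cy Py]] := rank_ge_next n Pg bg.
by exists y; split=> //; apply: IH => //; rewrite -rcons_cat.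
Qed.

(** Ranks are consumed from the right: the summand c is spent first, and rank
b is left at every stage. *)
Lemma rank_geD P b c s : rank_ge C P (oadd b c) s ->
  rank_ge C (rank_ge C P b) c s.
Proof.
elim/(well_founded_ind cord_lt_wf): c s => c IH s Pg; constructor.
  exact: rank_ge_le (oadd_leW b c) Pg.
move=> d n dc; have [y [Cy Py]] := rank_ge_next n Pg (oadd_lt b dc).
by exists y; split=> //; apply: IH.
Qed.

End Rank.

(** On trees of natural numbers the next entry can be chosen arbitrarily
large: this makes ranks insensitive to discarding an initial segment of the
integers. *)
Definition nrank_ge := @rank_ge nat (fun n y : nat => (n < y)%N).

(** Since the next entry is as large as desired, one may keep to increasing
sequences beyond n. *)
Lemma nrank_ge_sorted P g n : nrank_ge P g [::] ->
  nrank_ge (fun t => P t /\ path ltn n t) g [::].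
Proof.
pose Q t := P t /\ path ltn n t.
suff H t : path ltn n t -> nrank_ge P g t -> nrank_ge Q g t.
  exact: (H [::]).
elim/(well_founded_ind cord_lt_wf): g t => g IH t nt Pg; constructor.
  by split=> //; apply: rank_ge_here Pg.
move=> b m bg; have [y [my Py]] := rank_ge_next (maxn m (last n t)) Pg bg.
move: my; rewrite gtn_max => /andP[my ty].
by exists y; split=> //; apply: IH => //; rewrite rcons_path nt.
Qed.

(** * Small families *)

Section Small.
Variable R : realType.
Implicit Types (G : {fset nat} -> Prop) (P : seq nat -> Prop) (e : R).

Definition mass (a : nat -> R) (t : seq nat) (F : {fset nat}) : R :=
  \sum_(x <- t | x \in F) a x.

(** A quantitative form of the statement that G has rank at most omega ^ xi.  In
contrast to the rank, it passes through convolutions without any discussion of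
the possible decompositions of a set. *)
Definition small G (xi : cord) := forall P e, 0 < e ->
  nrank_ge P (omegapow xi) [::] ->
  exists t a, [/\ P t, forall x, 0 <= a x, \sum_(x <- t) a x = 1
    & forall F, G F -> mass a t F <= e].

Lemma small_gt G xi P e n : small G xi -> 0 < e ->
  nrank_ge P (omegapow xi) [::] ->
  exists t a, [/\ P t /\ path ltn n t, forall x, 0 <= a x, \sum_(x <- t) a x = 1
    & forall F, G F -> mass a t F <= e].
Proof. by move=> sG e0 /(nrank_ge_sorted n) /(sG _ e e0). Qed.

Lemma small_le G xi xi' : (xi <= xi')%O -> small G xi -> small G xi'.
Proof.
by move=> le_xi sG P e e0 /(rank_ge_le (omegapow_le le_xi)) /(sG P e e0).
Qed.

Lemma mass_ge0 a t F : (forall x, 0 <= a x) -> 0 <= mass a t F.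
Proof. by move=> a0; apply: sumr_ge0. Qed.

Lemma mass_le_sum a t F : (forall x, 0 <= a x) -> mass a t F <= \sum_(x <- t) a x.
Proof.
move=> a0; rewrite /mass [leRHS](bigID (mem F))/= lerDl; exact: sumr_ge0.
Qed.

Lemma mass_cat a s t F : mass a (s ++ t) F = mass a s F + mass a t F.
Proof. by rewrite /mass big_cat. Qed.

Lemma eq_mass a b t F : {in t, a =1 b} -> mass a t F = mass b t F.
Proof.
move=> ab; rewrite /mass big_seq_cond [RHS]big_seq_cond.
by apply: eq_bigr => x /andP[/ab].
Qed.

Lemma mass_sub a t E F : (forall x, 0 <= a x) ->
  (forall x, x \in t -> x \in E -> x \in F) -> mass a t E <= mass a t F.
Proof.
move=> a0 EF; rewrite /mass [leLHS]big_mkcond [leRHS]big_mkcond big_seq [leRHS]big_seq.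
apply: ler_sum => x xt; case: ifPn => [xE|_]; first by rewrite EF.
by case: ifP.
Qed.

Definition splice (a : nat -> R) (s : seq nat) (b : nat -> R) (x : nat) : R :=
  if x \in s then a x else b x.

Lemma sum_splice a s b t : (forall x, x \in t -> x \notin s) ->
  \sum_(x <- s ++ t) splice a s b x = \sum_(x <- s) a x + \sum_(x <- t) b x.
Proof.
move=> ts; rewrite big_cat; congr (_ + _); apply: eq_big_seq => x xs.
  by rewrite /splice xs.
by rewrite /splice (negbTE (ts x xs)).
Qed.

Lemma mass_splice a s b t F : (forall x, x \in t -> x \notin s) ->
  mass (splice a s b) (s ++ t) F = mass a s F + mass b t F.
Proof.
move=> ts; rewrite mass_cat; congr (_ + _); apply: eq_mass => x xs.
  by rewrite /splice xs.
by rewrite /splice (negbTE (ts x xs)).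
Qed.

Lemma path_ltn_last n s : path ltn n s -> (n <= last n s)%N.
Proof. by elim: s n => //= y s IH n /andP[/ltnW ny /IH]; apply: leq_trans. Qed.

Lemma path_ltn_le_last n s x : path ltn n s -> x \in s -> (x <= last n s)%N.
Proof.
elim: s n => //= y s IH n /andP[_ ys]; rewrite inE => /orP[/eqP->|/IH]; last exact.
exact: path_ltn_last.
Qed.

Lemma path_ltn_gt n s x : path ltn n s -> x \in s -> (n < x)%N.
Proof. by move=> /(order_path_min ltn_trans)/allP; apply. Qed.

(** If the members of G that meet any given initial segment form a small family,
then average over many successive blocks: a member of G may have large
mass on the block where it starts, but it is small on all later ones. *)
Lemma small_succ G xi :
  (forall n, small (fun F => G F /\ exists2 x, x \in F & (x <= n)%N) xi) ->
  small G (osucc xi).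
Proof.
move=> sG P e e0; rewrite omegapowS => Pomega.
have e20 : 0 < e / 2 by rewrite divr_gt0.
suff blocks (M : nat) n Q : nrank_ge Q (omul (omegapow xi) (ofin M)) [::] ->
    exists t a, [/\ Q t /\ path ltn n t, forall x, 0 <= a x,
      \sum_(x <- t) a x = M%:R
      & forall F, G F -> mass a t F <= 1 + M%:R * (e / 2) /\
        ((exists2 x, x \in F & (x <= n)%N) -> mass a t F <= M%:R * (e / 2))].
  have [M Me] : exists M : nat, 2 / e <= M.+1%:R.
    have /archi_boundP be : 0 <= 2 / e by rewrite divr_ge0// ltW.
    exists (Num.bound (2 / e)); apply/ltW/(lt_le_trans be).
    by rewrite ler_nat.
  have {}/blocks : nrank_ge P (omul (omegapow xi) (ofin M.+1)) [::].
    by apply: rank_ge_le Pomega; apply/omul_le/ltW/ofin_lt_omega.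
  move=> /(_ 0%N)[t [a [[Pt _] a0 suma Ga]]].
  have M0 : 0 < M.+1%:R :> R by rewrite ltr0Sn.
  exists t, (fun x => a x / M.+1%:R); split=> //.
  - by move=> x; rewrite divr_ge0.
  - by rewrite -mulr_suml suma divff// gt_eqF.
  move=> F /Ga[Fa _]; rewrite /mass -mulr_suml ler_pdivrMr//.
  apply: le_trans Fa _; rewrite [e in leRHS](splitr e) mulrDl lerD//; last by rewrite mulrC.
  by rewrite -ler_pdivrMl// invf_div mulr1.
elim: M n Q => [|M IH] n Q; first last.
  rewrite omulS => /rank_geD /(small_gt n (sG n) e20).
  move=> [s [a [[Qs ns] a0 suma Ga]]].
  rewrite -[s]cats0 in Qs; have {}/(IH (last n s)) := rank_ge_shift Qs.
  move=> [t [b [[Qt st] b0 sumb Gb]]].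
  have ts x : x \in t -> x \notin s.
    move=> /(path_ltn_gt st); rewrite ltnNge; apply: contra.
    exact: path_ltn_le_last.
  exists (s ++ t), (splice a s b); split.
  - by rewrite cat_path ns.
  - by move=> x; rewrite /splice; case: ifP.
  - by rewrite sum_splice// suma sumb addrC natr1.
  move=> F GF; rewrite mass_splice// -natr1 mulrDl mul1r.
  have [Gb1 Gb2] := Gb F GF.
  have [[x xF xs]|nF] := pselect (exists2 x, x \in F & (x <= last n s)%N).
    have {}Gb2 := Gb2 (ex_intro2 _ _ x xF xs).
    split=> [|Fn].
      have := mass_le_sum s F a0; rewrite suma; lra.
    by rewrite addrC lerD// Ga.
  have -> : mass a s F = 0.
    rewrite /mass big_seq_cond big1// => x /andP[xs xF]; case: nF.
    by exists x => //; apply: path_ltn_le_last.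
  rewrite add0r; split; first lra.
  move=> [x xF xn]; case: nF; exists x => //; apply: leq_trans xn _.
  exact: path_ltn_last.
exists [::], (fun=> 0); split=> //.
- by split=> //; have := rank_ge_here H.
- by rewrite big_nil.
- by move=> F _; rewrite /mass big_nil mul0r; split=> [|//]; rewrite addr0 ler01.
Qed.

End Small.

(** * Regular families and convolutions *)

(** Heredity and spreading in one condition: f embeds G into F, moving
elements to the left. *)
Definition regular (S : {fset nat} -> Prop) := forall (F G : {fset nat}) (f : nat -> nat),
  S F -> (forall x, x \in G -> f x \in F /\ (f x <= x)%N) ->
  {in G &, forall x y, (x < y)%N -> (f x < f y)%N} -> S G.

Lemma regular_sub S (F G : {fset nat}) : regular S -> S F -> {subset G <= F} -> S G.
Proof. by move=> rS SF GF; apply: (rS _ _ id SF) => // x /GF. Qed.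

Definition fiber (f : nat -> nat) (G : {fset nat}) v : {fset nat} :=
  [fset x in G | f x == v]%fset.

Lemma in_fiber f G v x : (x \in fiber f G v) = (x \in G) && (f x == v).
Proof. by rewrite !inE. Qed.

(** M[N] described through the map f sending an element to the label m_i of
the piece in which it lies.  Labels need not separate the pieces here, so that
this form is immediately seen to be inherited by spreadings. *)
Definition labelled (M N : {fset nat} -> Prop) (G : {fset nat}) :=
  exists f : nat -> nat, [/\ forall x, x \in G -> (f x <= x)%N,
    {in G &, forall x y, (x <= y)%N -> (f x <= f y)%N},
    M [fset f x | x in G]%fset & forall v, N (fiber f G v)].

Lemma labelled_regular M N : regular M -> regular N -> regular (labelled M N).
Proof.
move=> rM rN F G g [f [fle fmono Mf Nf]] gP ginc; exists (f \o g); split.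
- by move=> x /gP[gF gx] /=; apply: leq_trans (fle _ gF) gx.
- move=> x y xG yG; rewrite leq_eqVlt => /orP[/eqP->//|/(ginc x y xG yG)/ltnW].
  by apply: fmono; [apply: (gP x xG).1|apply: (gP y yG).1].
- apply: (regular_sub rM Mf) => v /imfsetP[/= x /gP[gF _] ->].
  by apply/imfsetP; exists (g x).
- move=> v; apply: (rN _ _ g (Nf v)).
    move=> x; rewrite !in_fiber => /andP[/gP[gF gx] /= ->]; by rewrite gF.
  by move=> x y; rewrite !in_fiber => /andP[xG _] /andP[yG _]; apply: ginc.
Qed.

Lemma fset_min_mem (E : {fset nat}) : E != fset0 -> fset_min E \in E.
Proof.
move=> E0; have : size (sort leq E) != 0%N by rewrite size_sort cardfs_eq0.
rewrite /fset_min; case: (sort leq E) (mem_sort leq E) => //= x s Es _.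
by rewrite -Es mem_head.
Qed.

Lemma fset_min_le (E : {fset nat}) x : x \in E -> (fset_min E <= x)%N.
Proof.
rewrite -(mem_sort leq) /fset_min.
have := sort_sorted leq_total E; case: (sort leq E) => //= y s ys.
rewrite inE => /orP[/eqP->//|].
by move/allP: (order_path_min leq_trans ys) => h /h.
Qed.

Lemma mem_fset_neq0 (E : {fset nat}) x : x \in E -> E != fset0.
Proof. by apply: contraTneq => ->; rewrite inE. Qed.

(** Labelling the elements by the minimum of their piece separates the
pieces; the new set of labels is a spreading of the old one. *)
Lemma labelled_sep M N G : regular M -> labelled M N G ->
  exists f : nat -> nat, [/\ forall x, x \in G -> (f x <= x)%N,
    {in G &, forall x y, (x < y)%N -> f x = f y \/ (x < f y)%N},
    M [fset f x | x in G]%fset & forall x, x \in G -> N (fiber f G (f x))].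
Proof.
move=> rM [f [fle fmono Mf Nf]].
pose g x := fset_min (fiber f G (f x)).
have gP x : x \in G -> [/\ g x \in G, f (g x) = f x & (g x <= x)%N].
  move=> xG; have xf : x \in fiber f G (f x) by rewrite in_fiber xG eqxx.
  have := fset_min_mem (mem_fset_neq0 xf); rewrite in_fiber => /andP[? /eqP ?].
  by split=> //; apply: fset_min_le.
have gE x y : f x = f y -> g x = g y by rewrite /g => ->.
exists g; split.
- by move=> x /gP[].
- move=> x y xG yG xy; have [/gE|fxy] := eqVneq (f x) (f y); [by left|right].
  have [gyG fgy _] := gP y yG.
  rewrite ltnNge; apply/negP => /(fmono _ _ gyG xG); rewrite fgy => fyx.
  by move/negP: fxy; apply; rewrite eqn_leq fyx (fmono _ _ xG yG (ltnW xy)).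
- apply: (rM _ _ f Mf) => [v /imfsetP[/= x /gP[gG fg gx] ->]|].
    by rewrite fle//; split=> //; apply/imfsetP; exists (g x).
  move=> v w /imfsetP[/= x xG ->] /imfsetP[/= y yG ->] gxy.
  have [gxG fgx _] := gP x xG; have [gyG fgy _] := gP y yG.
  have := fmono _ _ gxG gyG (ltnW gxy); rewrite leq_eqVlt => /orP[|//].
  by rewrite fgx fgy => /eqP/gE gE'; rewrite gE' ltnn in gxy.
- move=> x xG; suff -> : fiber g G (g x) = fiber f G (f x) by [].
  apply/fsetP => y; rewrite !in_fiber; apply/andb_id2l => yG.
  apply/eqP/eqP => [gyx|/gE//].
  by have [_ <- _] := gP y yG; have [_ <- _] := gP x xG; rewrite gyx.
Qed.

Section SmallConvolution.
Variables (R : realType) (M N : {fset nat} -> Prop).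
Implicit Types (P : seq nat -> Prop) (e : R).

(** A block is represented by its largest entry, in qs; this suffices because M
is closed under spreading.  The map k sends an entry to its block, and a is a
probability vector on each block that gives mass at most e to the members
of N. *)
Let blocks e (s qs : seq nat) (k : nat -> nat) (a : nat -> R) :=
  [/\ forall x, x \in s -> [/\ k x \in qs, (x <= k x)%N
        & forall q, q \in qs -> (q < k x)%N -> (q < x)%N],
    forall x, 0 <= a x,
    forall q, q \in qs -> \sum_(x <- s | k x == q) a x = 1
  & forall q F, q \in qs -> N F -> \sum_(x <- s | (k x == q) && (x \in F)) a x <= e].

Let block_tree e P qs := path ltn 0 qs /\
  exists s k a, P s /\ blocks e s qs k a.

(* Rank omega ^ xi is spent on every block. *)
Let block_tree_rank xi e P : small R N xi -> 0 < e -> forall d s qs k a,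
  nrank_ge P (omul (omegapow xi) d) s -> path ltn 0 qs -> blocks e s qs k a ->
  nrank_ge (block_tree e P) d qs.
Proof.
move=> sN e0; elim/(well_founded_ind cord_lt_wf) => d IH s qs k a Pd qs0 B.
constructor; first by split=> //; exists s, k, a; split=> //; apply: rank_ge_here Pd.
move=> d' n d'd.
have /rank_geD : nrank_ge P (oadd (omul (omegapow xi) d') (omegapow xi)) s.
  by apply: rank_ge_le Pd; rewrite -omulS; apply: omul_le; rewrite cord_succ_ltP.
rewrite -[s]cats0 => /rank_ge_shift /(small_gt (maxn n (last 0%N qs)) sN e0).
move=> [t [b [[Pt tpath] b0 sumb Nb]]].
have tn x : x \in t -> (maxn n (last 0%N qs) < x)%N by apply: path_ltn_gt.
pose y := last (maxn n (last 0%N qs)) t.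
have yt : y \in t.
  rewrite /y; case: (t) sumb => [|z t' _]; last exact: mem_last.
  by rewrite big_nil => /eqP; rewrite eq_sym oner_eq0.
have := tn y yt; rewrite gtn_max => /andP[ny qy].
have qsy q : q \in qs -> (q < y)%N.
  by move/(path_ltn_le_last qs0)/leq_ltn_trans; apply.
have [Bk Ba B1 BN] := B.
have sqs x : x \in s -> (x <= last 0%N qs)%N.
  move=> /Bk[kq xk _]; apply: leq_trans xk _; exact: path_ltn_le_last kq.
have ts x : x \in t -> x \notin s.
  move/tn; rewrite gtn_max => /andP[_ qx]; apply/negP => /sqs.
  by rewrite leqNgt qx.
have st x : x \in s -> x \notin t by apply: contraL => /ts.
have yqs : y \notin qs by apply/negP => /qsy; rewrite ltnn.
exists y; split=> //.
pose k' x := if x \in t then y else k x.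
apply: (IH d' d'd (s ++ t) _ k' (splice b t a)) => //.
  by rewrite rcons_path qs0.
have sumE (p : pred nat) q : q \in rcons qs y ->
    \sum_(x <- s ++ t | (k' x == q) && p x) splice b t a x =
    if q == y then \sum_(x <- t | p x) b x
    else \sum_(x <- s | (k x == q) && p x) a x.
  move=> qin; rewrite big_cat/= [X in X + _]big_seq_cond [X in _ + X]big_seq_cond.
  rewrite (eq_bigl (fun x => [&& x \in s, k x == q & p x])); last first.
    by move=> x; case xs: (x \in s) => //=; rewrite /k' (negbTE (st _ xs)).
  rewrite [X in _ + X](eq_bigl (fun x => [&& x \in t, y == q & p x])); last first.
    by move=> x; case xt: (x \in t) => //=; rewrite /k' xt.
  have [->|qy'] := eqVneq q y.
    rewrite big1 ?add0r => [|x /and3P[/Bk[kxq _ _] /eqP kxy _]]; last first.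
      by rewrite -kxy kxq in yqs.
    rewrite [RHS]big_seq_cond; apply: eq_big => [x|x /and3P[xt _ _]].
      by [].
    by rewrite /splice xt.
  rewrite [X in _ + X]big1 ?addr0 => [|x /and3P[//]].
  rewrite [RHS]big_seq_cond; apply: eq_bigr => x /and3P[xs _ _].
  by rewrite /splice (negbTE (st _ xs)).
split.
- move=> x; rewrite mem_cat /k' mem_rcons inE; case: ifPn => [xt _|xt].
    rewrite eqxx; split=> //; first exact: path_ltn_le_last.
    move=> q; rewrite mem_rcons inE => /orP[/eqP->|qqs _]; first by rewrite ltnn.
    move/tn: xt; rewrite gtn_max => /andP[_]; apply: leq_ltn_trans.
    exact: path_ltn_le_last qqs.
  rewrite orbF => xs; have [kxq xk kq] := Bk x xs; rewrite kxq orbT; split=> // q.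
  rewrite mem_rcons inE => /orP[/eqP->|]; last exact: kq.
  by move=> /ltnW; rewrite leqNgt qsy.
- by move=> x; rewrite /splice; case: ifP.
- move=> q qin; have := sumE xpredT q qin; rewrite (eq_bigl (fun x => k' x == q)) => [->|x]; last by rewrite andbT.
  case: eqVneq => [//|qy']; rewrite (eq_bigl (fun x => k x == q)) => [|x]; last by rewrite andbT.
  by apply: B1; move: qin; rewrite mem_rcons inE (negbTE qy').
- move=> q F qin NF; rewrite (sumE (fun x => x \in F))//.
  case: eqVneq => [_|qy']; first exact: Nb.
  by apply: BN => //; move: qin; rewrite mem_rcons inE (negbTE qy').
Qed.

(** Average over N-small blocks with weights that are M-small on the block
maxima: the blocks in which a new piece of a member of M[N] begins carry small
weight, and every other block meets a single piece. *)
Lemma small_labelled xi mu : regular M -> small R M mu -> small R N xi ->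
  small R (labelled M N) (oadd xi mu).
Proof.
move=> rM sM sN P e e0; rewrite omegapowD => Prank.
have e20 : 0 < e / 2 by rewrite divr_gt0.
have B0 : blocks (e / 2) [::] [::] id (fun=> 0) by split.
have /(sM _ _ e20)[qs [c [[qs0 [s [k [a [Ps [Bk Ba B1 BN]]]]]] c0 sumc Mc]]] :=
  @block_tree_rank xi _ P sN e20 _ _ [::] _ _ Prank isT B0.
have uqs : uniq qs by apply: (sorted_uniq ltn_trans ltnn); case: (qs) qs0 => //= q l /andP[].
have sumE (p : pred nat) : \sum_(x <- s | p x) c (k x) * a x =
    \sum_(q <- qs) c q * \sum_(x <- s | (k x == q) && p x) a x.
  under [RHS]eq_bigr do rewrite mulr_sumr big_mkcond.
  rewrite exchange_big/= [LHS]big_mkcond big_seq [RHS]big_seq.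
  apply: eq_bigr => x /Bk[kxq _ _].
  rewrite (bigD1_seq (k x))//= eqxx/= big1 ?addr0// => q.
  by rewrite eq_sym => /negbTE->.
exists s, (fun x => c (k x) * a x); split=> //.
- by move=> x; rewrite mulr_ge0.
- rewrite sumE -[RHS]sumc big_seq [RHS]big_seq; apply: eq_bigr => q qqs.
  rewrite (eq_bigl (fun x => k x == q)) => [|x]; last by rewrite andbT.
  by rewrite B1// mulr1.
move=> F /(labelled_sep rM)[f [fle fsep Mf Nf]].
(* Block q contains an element whose piece starts after all earlier blocks. *)
pose new q x := [&& x \in s, k x == q, x \in F & all (fun q' => (q' < q)%N ==> (q' < f x)%N) qs].
pose J := [fset q in qs | has (new q) s]%fset.
have MJ : M J.
  pose g q := f (nth 0%N s (find (new q) s)).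
  have gP q : q \in J -> new q (nth 0%N s (find (new q) s)).
    by rewrite !inE => /andP[_]; apply: nth_find.
  have gle q : q \in J -> (g q <= q)%N.
    move=> /gP/and4P[xs /eqP kx xF _]; apply: leq_trans (fle _ xF) _.
    by case: (Bk _ xs); rewrite kx.
  apply: (rM _ _ g Mf) => [q qJ|p q pJ qJ pq].
    by split; [apply/imfsetP; exists (nth 0%N s (find (new q) s)) => //; case/and4P: (gP q qJ)|exact: gle].
  apply: leq_ltn_trans (gle p pJ) _.
  have /and4P[_ _ _ /allP/(_ p)] := gP q qJ; rewrite pq; apply.
  by move: pJ; rewrite !inE => /andP[].
rewrite /mass (sumE (fun x => x \in F)).
(* In a block where no piece starts, all elements of F lie in one piece. *)
have mass1 q : q \in qs ->
    \sum_(x <- s | (k x == q) && (x \in F)) a x <= (q \in J)%:R + e / 2.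
  move=> qqs; have [qJ|qJ] := boolP (q \in J).
    apply: le_trans (_ : 1 <= _); last by rewrite lerDl ltW.
    rewrite -[leRHS](B1 q qqs) big_mkcond [leRHS]big_mkcond; apply: ler_sum => x _.
    by case: eqP => //= _; case: ifP.
  rewrite add0r.
  have old x : x \in s -> k x = q -> x \in F -> exists2 q', q' \in qs /\ (q' < q)%N & (f x <= q')%N.
    move=> xs kx xF; move: qJ; rewrite !inE qqs/= => /hasPn/(_ x xs).
    rewrite /new xs kx eqxx xF/= => /allPn[q' q'qs]; rewrite negb_imply -leqNgt => /andP[].
    by exists q'.
  have [/hasP[x xs /andP[/eqP kx xF]]|/hasPn none] := boolP (has (fun x => (k x == q) && (x \in F)) s); last first.
    by rewrite big_seq_cond big1 ?ltW// => x /andP[/none/negbTE->].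
  have [q' [q'qs q'q] fxq'] := old x xs kx xF.
  apply: le_trans (BN q _ qqs (Nf x xF)).
  have same y : y \in s -> k y = q -> y \in F -> f y = f x.
    suff H u v : u \in s -> v \in s -> k u = q -> k v = q -> u \in F -> v \in F -> (u < v)%N -> f u = f v.
      move=> ys ky yF; case: (ltngtP x y) => [xy|yx|->//]; first by rewrite (H x y).
      by rewrite (H y x).
    move=> us vs ku kv uF vF uv; have [//|ufv] := fsep u v uF vF uv.
    have [p [pqs pq] fvp] := old v vs kv vF.
    have [_ _ /(_ p pqs)] := Bk u us; rewrite ku => /(_ pq).
    by rewrite ltnNge (leq_trans (ltnW ufv)).
  rewrite big_mkcond [leRHS]big_mkcond big_seq [leRHS]big_seq; apply: ler_sum => y ys.
  case: eqP => [ky|//]; rewrite in_fiber /=; case: ifP => [yF|_].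
    by rewrite (same y)// eqxx.
  by [].
apply: le_trans (_ : \sum_(q <- qs) c q * ((q \in J)%:R + e / 2) <= _).
  rewrite big_seq [leRHS]big_seq; apply: ler_sum => q qqs.
  by apply: ler_wpM2l => //; apply: mass1.
under eq_bigr do rewrite mulrDr.
rewrite big_split/= -mulr_suml sumc mul1r [leRHS]splitr lerD2r.
apply: le_trans (Mc J MJ); rewrite /mass [leRHS]big_mkcond; apply: ler_sum => q _.
by case: ifP; rewrite ?mulr1 ?mulr0.
Qed.

End SmallConvolution.

Lemma nat_le_fsetP n (F : {fset nat}) :
  reflect (forall x, x \in F -> (n <= x)%N) (nat_le_fset n F).
Proof. exact: allP. Qed.

Lemma fset_lt_natP n (F : {fset nat}) :
  reflect (forall x, x \in F -> (x < n)%N) (fset_lt_nat F n).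
Proof. exact: allP. Qed.

Lemma convolution_labelled M N : regular M -> regular N ->
  convolution M N `<=` labelled M N.
Proof.
move=> rM rN G [k [m [F [k0 Mm FP msep ->]]]].
set G' := (\bigcup_(i <- iota 0 k) F i)%fset.
have G'P x : reflect (exists2 i, (i < k)%N & x \in F i) (x \in G').
  apply: (iffP (bigfcupP _ _ _ _)) => [[i]|[i ik xF]].
    by rewrite mem_iota andbT => ik xF; exists i.
  by exists i => //; rewrite mem_iota andbT.
have mlt i j : (i < j)%N -> (j < k)%N -> (m i < m j)%N.
  elim: j => // j IH; rewrite ltnS leq_eqVlt => /orP[/eqP->|ij] jk.
    by have [] := msep _ jk.
  by apply: ltn_trans (IH ij (ltnW jk)) _; have [] := msep _ jk.
have mle i j : (i <= j)%N -> (j < k)%N -> (m i <= m j)%N.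
  by rewrite leq_eqVlt => /orP[/eqP->//|ij jk]; apply/ltnW/mlt.
pose idx x := find (fun i => x \in F i) (iota 0 k).
have idxP x : x \in G' -> (idx x < k)%N /\ x \in F (idx x).
  move=> /G'P[i ik xF].
  have h : has (fun i => x \in F i) (iota 0 k).
    by apply/hasP; exists i => //; rewrite mem_iota.
  have idk : (idx x < k)%N by move: h; rewrite has_find size_iota.
  by split=> //; have := nth_find 0%N h; rewrite nth_iota.
have mx x : x \in G' -> (m (idx x) <= x)%N.
  by move=> /idxP[/FP[_ /nat_le_fsetP h]]; apply: h.
exists (m \o idx); split=> //.
- move=> x y xG yG xy /=; have [ik xF] := idxP x xG; have [jk yF] := idxP y yG.
  apply: (mle) => //; rewrite leqNgt; apply/negP => ji.
  have jk' : ((idx y).+1 < k)%N by apply: leq_ltn_trans ik.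
  have [/fset_lt_natP/(_ y yF) ym _] := msep _ jk'.
  have := leq_ltn_trans xy (leq_trans ym (mle _ _ ji ik)).
  by rewrite ltnNge mx.
- apply: (regular_sub rM Mm) => _ /imfsetP[/= x /idxP[ik _] ->].
  by apply/imfsetP; exists (idx x) => //=; rewrite mem_iota.
- move=> v; have [->|[x]] := fset_0Vmem (fiber (m \o idx) G' v).
    by apply: (regular_sub rN (FP _ k0).1) => x; rewrite inE.
  rewrite in_fiber => /andP[xG /= /eqP xv]; have [ik xF] := idxP x xG.
  apply: (regular_sub rN (FP _ ik).1) => y.
  rewrite in_fiber => /andP[/idxP[jk yF] /= /eqP yv].
  suff <- : idx y = idx x by [].
  case: (ltngtP (idx y) (idx x)) => // [/mlt|/mlt] => [/(_ ik)|/(_ jk)];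
  by rewrite yv xv ltnn.
Qed.

Lemma labelled_convolution M N : regular M -> M [fset 1%N]%fset -> N fset0 ->
  labelled M N `<=` convolution M N.
Proof.
move=> rM M1 N0 G /(labelled_sep rM)[f [fle fsep Mf Nf]].
have [->|[x0 x0G]] := fset_0Vmem G.
  exists 1%N, (fun=> 1%N), (fun=> fset0); split=> //.
  - rewrite (_ : [fset _ | i in _]%fset = [fset 1%N]%fset)//.
    apply/fsetP => x; rewrite inE; apply/imfsetP/eqP => [[]//|->].
    by exists 0%N.
  - by rewrite big1_eq.
pose V := [fset f x | x in G]%fset; pose vs := sort leq V.
have vsV v : (v \in vs) = (v \in V) by rewrite mem_sort.
have vslt : sorted ltn vs.
  by rewrite ltn_sorted_uniq_leq sort_uniq fset_uniq/= (sort_sorted leq_total).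
have nthV i : (i < size vs)%N -> nth 0%N vs i \in V by move=> /(mem_nth 0%N); rewrite vsV.
have GV x : x \in G -> f x \in V by move=> xG; apply/imfsetP; exists x.
exists (size vs), (nth 0%N vs), (fun i => fiber f G (nth 0%N vs i)); split.
- by rewrite -has_predT; apply/hasP; exists (f x0) => //; rewrite vsV GV.
- suff -> : [fset nth 0 vs i | i in iota 0 (size vs)]%fset = V by [].
  apply/fsetP => v; rewrite -[in RHS]vsV; apply/imfsetP/(nthP 0%N) => /=.
    by move=> [i]; rewrite mem_iota => /= ik ->; exists i.
  by move=> [i ik <-]; exists i => //; rewrite mem_iota.
- move=> i /nthV/imfsetP[/= x xG vx]; rewrite vx; split; first exact: Nf.
  by apply/nat_le_fsetP => y; rewrite in_fiber => /andP[yG /eqP <-]; apply: fle.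
- move=> i ik; have vlt : (nth 0 vs i < nth 0 vs i.+1)%N.
    by apply: (sorted_ltn_nth ltn_trans) => //; rewrite inE ?(ltnW ik).
  split=> //; apply/fset_lt_natP => x; rewrite in_fiber => /andP[xG /eqP fx].
  have /imfsetP[/= y yG fy] := nthV _ ik.
  have [xy|yx|xy] := ltngtP x y.
  + by have [fxy|] := fsep x y xG yG xy; [move: vlt; rewrite -fx fxy fy ltnn|rewrite -fy].
  + have [fxy|yfx] := fsep y x yG xG yx; first by move: vlt; rewrite -fx -fxy fy ltnn.
    have := leq_ltn_trans (fle y yG) yfx.
    by rewrite -fy fx => /(ltn_trans vlt); rewrite ltnn.
  + by move: vlt; rewrite -fx fy xy ltnn.
- apply/fsetP => x; apply/idP/bigfcupP => /= [xG|[i _]]; last first.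
    by rewrite in_fiber => /andP[].
  have /(nthP 0%N)[i ik vx] : f x \in vs by rewrite vsV GV.
  by exists i; [rewrite mem_iota andbT|rewrite in_fiber xG vx eqxx].
Qed.

(** * Schreier families *)

Lemma schreier0_regular : regular schreier0.
Proof.
move=> F G f SF fP finc; have [->|[x xG]] := fset_0Vmem G; first by left.
right; case: SF => [F0|[n n1 Fn]].
  by have [] := fP x xG; rewrite F0 inE.
have fE y : y \in G -> f y = n by move/fP => []; rewrite Fn inE => /eqP.
exists x; first by have [_] := fP x xG; rewrite fE//; apply: leq_trans.
apply/fsetP => y; rewrite inE; apply/idP/eqP => [yG|->//].
have [xy|yx|//] := ltngtP x y.
  by have := finc x y xG yG xy; rewrite !fE// ltnn.
by have := finc y x yG xG yx; rewrite !fE// ltnn.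
Qed.

Lemma schreier1_regular : regular schreier1.
Proof.
move=> F G f /nat_le_fsetP SF fP finc; apply/nat_le_fsetP => x xG.
have [fF fx] := fP x xG; apply: leq_trans (leq_trans (SF _ fF) fx).
have <- : #|` [fset f y | y in G]%fset| = #|` G|.
  rewrite card_in_imfset//= => y z yG zG.
  have [yz|zy|//] := ltngtP y z.
    by have := finc y z yG zG yz => /[swap] ->; rewrite ltnn.
  by have := finc z y zG yG zy => /[swap] ->; rewrite ltnn.
by apply/fsubset_leq_card/fsubsetP => _ /imfsetP[/= y /fP[yF _] ->].
Qed.

Lemma schreier1_1 : schreier1 [fset 1%N]%fset.
Proof. by apply/nat_le_fsetP => x; rewrite inE cardfs1 => /eqP->. Qed.

Section Schreier.
Variables (fs : cord -> nat -> cord) (hfs : fundamental_sequences fs).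
Notation S := (schreier fs).

Lemma fundamental_lt a n : is_limit a -> (fs a n < a)%O.
Proof.
move=> /hfs[inc [ub _]]; apply: lt_le_trans (inc n) _.
by apply: ub; exists n.+1.
Qed.

Lemma fundamental_cofinal a b : is_limit a -> (b < a)%O -> exists n, (b < fs a n)%O.
Proof.
move=> /hfs[_ [_ lub]] ba; apply: contrapT => nb.
suff : (a <= b)%O by rewrite leNgt ba.
apply: lub => _ [n _ <-]; rewrite leNgt; apply/negP => bn; apply: nb.
by exists n.
Qed.

Lemma schreier_regular a : regular (S a) /\ forall n, (0 < n)%N -> S a [fset n]%fset.
Proof.
elim/cord_ind: a => [|a [rS S1]|l ll IH].
- rewrite schreier_0; split; first exact: schreier0_regular.
  by move=> n n0; right; exists n.
- rewrite schreier_succ.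
  have conv : convolution schreier1 (S a) = labelled schreier1 (S a).
    apply/seteqP; split; first exact: convolution_labelled schreier1_regular rS.
    apply: labelled_convolution schreier1_regular schreier1_1 _.
    by apply: (regular_sub rS (S1 1%N isT)) => x; rewrite inE.
  rewrite conv; split; first exact: labelled_regular schreier1_regular rS.
  move=> n n0; exists id; split=> //.
    rewrite imfset_id; apply/nat_le_fsetP => x.
    by rewrite inE cardfs1 => /eqP->.
  by move=> v; apply: (regular_sub rS (S1 n n0)) => x; rewrite in_fiber => /andP[].
- rewrite schreier_limit//; split.
    move=> F G f [n [SF /nat_le_fsetP nF]] fP finc; exists n; split.
      exact: (IH _ (fundamental_lt n ll)).1 SF fP finc.
    apply/nat_le_fsetP => x /fP[/nF nf]; exact: leq_trans.
  move=> n n0; exists 0%N; split; first exact: (IH _ (fundamental_lt 0 ll)).2.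
  by apply/nat_le_fsetP => x; rewrite inE => /eqP->.
Qed.

Lemma schreier_succE a : S (osucc a) = labelled schreier1 (S a).
Proof.
rewrite schreier_succ; have [rS S1] := schreier_regular a.
apply/seteqP; split; first exact: convolution_labelled schreier1_regular rS.
apply: labelled_convolution schreier1_regular schreier1_1 _.
by apply: (regular_sub rS (S1 1%N isT)) => x; rewrite inE.
Qed.

Lemma schreier_gt0 a F : S a F -> 0%N \notin F.
Proof.
elim/cord_ind: a F => [|a IH|l ll IH] F.
- by rewrite schreier_0 => -[->|[n n0 ->]]; rewrite !inE// eq_sym -lt0n.
- rewrite schreier_succE => -[f [fle _ _ Sf]]; apply/negP => F0.
  by have /negP := IH _ (Sf (f 0%N)); apply; rewrite in_fiber F0 eqxx.
- rewrite schreier_limit// => -[n [SF _]]; exact: IH (fundamental_lt n ll) _ SF.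
Qed.

(** The families need not increase, since the fundamental sequences are
arbitrary, but they do so on sets far enough to the right. *)
Lemma schreier_eventually a b : (b < a)%O -> exists n, forall F,
  S b F -> (forall x, x \in F -> (n <= x)%N) -> S a F.
Proof.
elim/cord_ind: a b => [|a IH|l ll IH] b ba.
- by move: ba; rewrite ltNge ozero_le.
- have [n Sn] : exists n, forall F,
    S b F -> (forall x, x \in F -> (n <= x)%N) -> S a F.
    by move: ba; rewrite lt_osuccE le_eqVlt => /orP[/eqP->|/IH//]; exists 0%N.
  exists n => F SF nF; rewrite schreier_succE.
  have [rS S1] := schreier_regular a.
  exists (fun=> fset_min F); split=> //.
  + by move=> x /fset_min_le.
  + apply/nat_le_fsetP => _ /imfsetP[/= x xF ->].
    have x0 := fset_min_mem (mem_fset_neq0 xF).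
    apply: leq_trans (_ : 1 <= _)%N.
      rewrite -(cardfs1 (fset_min F)); apply/fsubset_leq_card/fsubsetP.
      by move=> _ /imfsetP[/= y _ ->]; rewrite inE.
    rewrite lt0n; apply: contraNneq (schreier_gt0 SF) => <-; exact: x0.
  + move=> v; apply: (regular_sub rS (Sn F SF nF)) => x.
    by rewrite in_fiber => /andP[].
- have [n bn] := fundamental_cofinal ll ba.
  have [m Sm] := IH _ (fundamental_lt n ll) _ bn.
  exists (maxn m n.+1) => F SF F_ge; rewrite schreier_limit//; exists n; split.
    by apply: Sm => // x /F_ge; rewrite geq_max => /andP[].
  by apply/nat_le_fsetP => x /F_ge; rewrite geq_max => /andP[].
Qed.

Lemma schreier0_small (R : realType) : small R schreier0 oone.
Proof.
apply: small_succ => n P e e0; rewrite omegapow0 => P1.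
have [y [ny Py]] := rank_ge_next n P1 (lt_osucc ozero).
exists [:: y], (fun=> 1); split.
- exact: rank_ge_here Py.
- by move=> _; apply: ler01.
- by rewrite big_seq1.
move=> F [F0 [x xF xn]]; rewrite /mass big_cons big_nil; case: ifPn => [yF|_]; last exact: ltW.
case: F0 xF yF => [->|[z _ ->]]; rewrite !inE// => /eqP xz /eqP yz.
by move: ny; rewrite yz -xz ltnNge xn.
Qed.

(** By [small_succ] only the sets meeting [0, n] matter.  At a successor these are
unions of at most n members of S_a; at a limit they belong to finitely many
earlier families, which far to the right are contained in a single one. *)
Lemma schreier_small (R : realType) a : small R (S a) (osucc a).
Proof.
elim/cord_ind: a => [|a IH|l ll IH].
- by rewrite schreier_0; apply: schreier0_small.
- apply: small_succ => n P e e0 Pa; rewrite schreier_succE.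
  have en0 : 0 < e / n.+1%:R by rewrite divr_gt0.
  have [t [c [Pt c0 sumc Sc]]] := IH P _ en0 Pa; exists t, c; split=> //.
  move=> F [[f [fle _ S1f Sf]] [x xF xn]].
  pose V := [fset f x | x in F]%fset.
  have Vn : (#|` V| <= n)%N.
    move/nat_le_fsetP: S1f => /(_ (f x)) => h; apply: leq_trans (leq_trans (fle x xF) xn).
    by apply: h; apply/imfsetP; exists x.
  apply: le_trans (_ : \sum_(v <- V) mass c t (fiber f F v) <= _).
    rewrite /mass; under [leRHS]eq_bigr do rewrite big_mkcond.
    rewrite exchange_big/= big_mkcond; apply: ler_sum => y _.
    case: ifPn => [yF|_]; last by apply: sumr_ge0 => v _; case: ifP.
    have yV : f y \in V by apply/imfsetP; exists y.
    rewrite (bigD1_seq (f y) yV (fset_uniq V)) in_fiber yF eqxx lerDl.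
    by apply: sumr_ge0 => v _; case: ifP.
  apply: le_trans (_ : \sum_(v <- V) e / n.+1%:R <= _); first by apply: ler_sum => v _; apply: Sc.
  rewrite big_const_seq count_predT iter_addr_0 -[leLHS]mulr_natr -mulrA ger_pMr//.
  rewrite ler_pdivrMl// mulr1 ler_nat; exact: leq_trans Vn _.
- apply: small_succ => n P e e0 Pl.
  have ev i : exists m, (i < n)%N -> forall F,
      S (fs l i) F -> (forall x, x \in F -> (m <= x)%N) -> S (fs l n) F.
    case: (ltnP i n) => [i_n|_]; last by exists 0%N.
    have : (fs l i < fs l n)%O.
      have [inc _] := hfs ll; elim: (n) i_n => // k IHk; rewrite ltnS leq_eqVlt.
      by move=> /orP[/eqP->//|/IHk h]; apply: lt_trans (inc k).
    by move=> /schreier_eventually[m Sm]; exists m.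
  have [m Sm] := choice ev.
  pose N := \max_(i < n) m i.
  have sn := IH _ (fundamental_lt n ll).
  have le_l : (osucc (fs l n) <= l)%O by rewrite cord_succ_ltP; apply: fundamental_lt.
  have [t [c [[Pt Nt] c0 sumc Sc]]] := small_gt N (small_le le_l sn) e0 Pl.
  exists t, c; split=> //; rewrite schreier_limit// => F [[i [SF /nat_le_fsetP iF]] [x xF xn]].
  have i_n : (i < n)%N := leq_trans (iF x xF) xn.
  pose F' := [fset x in F | (N <= x)%N]%fset.
  apply: le_trans (Sc F' _).
    by apply: mass_sub => // y /(path_ltn_gt Nt)/ltnW Ny yF; rewrite !inE yF.
  apply: (Sm i i_n) => [|y]; last first.
    rewrite !inE => /andP[_]; apply: leq_trans.
    exact: (@leq_bigmax _ (fun i : 'I_n => m i) (Ordinal i_n)).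
  have [rS _] := schreier_regular (fs l i).
  by apply: (regular_sub rS SF) => y; rewrite !inE => /andP[].
Qed.

End Schreier.

(** * Lower bounds for the ranks of families *)

Definition in_family (G : {fset nat} -> Prop) (s : seq nat) : Prop :=
  G [fset x in s]%fset.

Section RankConvolution.
Variables (M N : {fset nat} -> Prop) (b : cord).
Hypotheses (rM : regular M) (b0 : (ozero < b)%O).
Hypothesis Nrank : nrank_ge (in_family N) b [::].

(** The list ms contains the labels used so far, f assigns them to the entries
of s, and r is the piece under construction, with label last 0 ms. *)
Let state (s ms r : seq nat) (f : nat -> nat) :=
  [/\ path ltn 0 s, path ltn 0 ms,
    forall x, x \in s -> (f x <= x)%N /\ f x \in ms,
    {in s &, forall x y, (x <= y)%N -> (f x <= f y)%N}
  & forall v, (v != last 0 ms -> N (fiber f [fset x in s]%fset v)) /\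
     fiber f [fset x in s]%fset (last 0 ms) = [fset x in r]%fset].

Let state_labelled s ms r f : state s ms r f -> M [fset x in ms]%fset ->
  N [fset x in r]%fset -> labelled M N [fset x in s]%fset.
Proof.
move=> [s0 ms0 fP fmono Nf] Mms Nr; exists f; split.
- by move=> x; rewrite !inE => /fP[].
- by move=> x y; rewrite !inE; apply: fmono.
- apply: (regular_sub rM Mms) => v /imfsetP[/= x xs ->].
  by move: xs; rewrite !inE => /fP[].
- move=> v; have [->|/(Nf v).1//] := eqVneq v (last 0 ms).
  by rewrite (Nf 0%N).2.
Qed.

Let state_next s ms r f y w ms' : state s ms r f -> path ltn 0 ms' ->
  {subset ms <= ms'} -> last 0 ms' = w -> w \in ms' -> (last 0 s < y)%N ->
  (w <= y)%N -> N [fset x in r]%fset ->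
  let f' x := if x == y then w else f x in
  (w = last 0 ms -> state (rcons s y) ms' (rcons r y) f') /\
  (w \notin ms -> state (rcons s y) ms' [:: y] f').
Proof.
move=> [s0 ms0 fP fmono Nf] ms'0 msms' lastw wms' sy wy Nr f'.
have ys : y \notin s.
  by apply/negP => /(path_ltn_le_last s0); rewrite leqNgt sy.
have s'0 : path ltn 0 (rcons s y) by rewrite rcons_path s0.
have f's x : x \in s -> f' x = f x.
  by rewrite /f'; case: eqP => // -> yin; rewrite yin in ys.
have f'y : f' y = w by rewrite /f' eqxx.
have f'P x : x \in rcons s y -> (f' x <= x)%N /\ f' x \in ms'.
  rewrite mem_rcons inE => /orP[/eqP->|xs]; first by rewrite f'y.
  by rewrite f's//; have [? /msms'] := fP x xs.
have f'mono : {in rcons s y &, forall x z, (x <= z)%N -> (f' x <= f' z)%N}.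
  move=> x z; rewrite !mem_rcons !inE => /orP[/eqP->|xs] /orP[/eqP->|zs] xz //.
  - have := leq_trans xz (path_ltn_le_last s0 zs).
    by rewrite leqNgt sy.
  - rewrite f'y f's// -lastw; apply: path_ltn_le_last => //.
    by apply: msms'; have [] := fP x xs.
  - by rewrite !f's//; apply: fmono.
have fib v : fiber f' [fset x in rcons s y]%fset v =
    if v == w then (y |` fiber f [fset x in s] v)%fset
    else fiber f [fset x in s]%fset v.
  apply/fsetP => x; rewrite in_fiber !inE mem_rcons inE.
  have [->|xy] /= := eqVneq x y.
    rewrite f'y eq_sym; case: eqP => _; first by rewrite !inE eqxx.
    by rewrite in_fiber !inE (negbTE ys).
  have -> : f' x = f x by rewrite /f' (negbTE xy).
  by case: ifP => _; rewrite ?inE ?(negbTE xy) ?in_fiber ?inE.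
have fold v : N (fiber f [fset x in s]%fset v).
  by have [->|/(Nf v).1//] := eqVneq v (last 0 ms); rewrite (Nf 0%N).2.
split=> wE; split=> // v; split.
- by rewrite lastw fib => /negbTE ->.
- rewrite lastw fib eqxx wE (Nf 0%N).2; apply/fsetP => x.
  by rewrite !inE mem_rcons inE.
- by rewrite lastw fib => /negbTE ->.
- rewrite lastw fib eqxx; apply/fsetP => x; rewrite in_fset1U in_fiber !inE.
  suff -> : (x \in s) && (f x == w) = false by rewrite orbF.
  by apply/negbTE/negP => /andP[/fP[_ /[swap] /eqP->]]; apply/negP.
Qed.

(* Having d steps left in M and p steps left in the current piece amounts to
rank b d + p: one either continues the piece or starts a new one, which has
rank b. *)
Let rank_state g : forall d p s ms r f, (g <= oadd (omul b d) p)%O ->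
  nrank_ge (in_family M) d ms -> nrank_ge (in_family N) p r ->
  (ms != [::] \/ p = ozero) -> state s ms r f ->
  nrank_ge (in_family (labelled M N)) g s.
Proof.
elim/(well_founded_ind cord_lt_wf): g => g IH d p s ms r f gdp Md Np msp st.
have Nr := rank_ge_here Np; have Mm := rank_ge_here Md.
have [s0 ms0 fP _ _] := st.
constructor; first exact: state_labelled st Mm Nr.
move=> c n cg.
have outer : (c < omul b d)%O -> exists y, (n < y)%N /\
    nrank_ge (in_family (labelled M N)) c (rcons s y).
  move=> /lt_omul[d' d'd cd'].
  have [p' [p'b cp']] : exists p', (p' < b)%O /\ (c <= oadd (omul b d') p')%O.
    have [/ltW cd|[p' p'b cp']] := lt_oadd cd'; last by exists p'.
    by exists ozero; rewrite oadd0.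
  have [m [mlarge Mm']] := rank_ge_next (maxn (last 0 s) (last 0 ms)) Md d'd.
  have [y [ylarge Ny]] := rank_ge_next (maxn (last 0 s) (maxn m n)) Nrank p'b.
  move: mlarge ylarge; rewrite !gtn_max => /andP[sm msm] /and3P[sy my ny].
  have msms' : {subset ms <= rcons ms m} by move=> x xms; rewrite mem_rcons inE xms orbT.
  have ms'0 : path ltn 0 (rcons ms m) by rewrite rcons_path ms0.
  have mms : m \notin ms by apply/negP => /(path_ltn_le_last ms0); rewrite leqNgt msm.
  exists y; split=> //.
  have [_ /(_ mms) st'] := @state_next s ms r f y m _ st ms'0 msms'
    (last_rcons _ _ _) (ltac:(by rewrite mem_rcons mem_head)) sy (ltnW my) Nr.
  apply: (IH c cg d' p' _ _ _ _ cp' Mm' Ny _ st'); left.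
  by rewrite -size_eq0 size_rcons.
have [/outer//|[p' p'p cp']] := lt_oadd (lt_le_trans cg gdp).
case: msp => [msN|p0]; last by move: p'p; rewrite p0 ltNge ozero_le.
have [y [ylarge Ny]] := rank_ge_next (maxn (last 0 s) (maxn (last 0 ms) n)) Np p'p.
move: ylarge; rewrite !gtn_max => /and3P[sy my ny].
exists y; split=> //.
have lms : last 0 ms \in ms by case: (ms) msN => //= x l _; apply: mem_last.
have [/(_ erefl) st' _] := @state_next s ms r f y (last 0 ms) ms st ms0
  (fun _ h => h) erefl lms sy (ltnW my) Nr.
by apply: (IH c cg d p' _ _ _ _ cp' Md Ny _ st'); left.
Qed.

(** Ranks multiply under convolution, each element of a member of M giving
room for a whole tree of rank b. *)
Lemma labelled_rank d : nrank_ge (in_family M) d [::] ->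
  nrank_ge (in_family (labelled M N)) (omul b d) [::].
Proof.
move=> Md.
have N0 : nrank_ge (in_family N) ozero [::] := rank_ge_le (ozero_le b) Nrank.
apply: (@rank_state _ d ozero [::] [::] [::] id) => //; first by rewrite oadd0.
  by right.
have E v : fiber id [fset x in [::]]%fset v = [fset x in [::]]%fset.
  by apply/fsetP => x; rewrite in_fiber !inE.
split=> // v; rewrite !E; split=> // _; exact: rank_ge_here N0.
Qed.

End RankConvolution.

Lemma schreier0_rank : nrank_ge (in_family schreier0) oone [::].
Proof.
constructor; first by left; apply/fsetP => x; rewrite !inE.
move=> c n; rewrite lt_osuccE => c0; exists n.+1; split=> //.
apply: (rank_ge_le c0); constructor => [|d m]; last by rewrite ltNge ozero_le.
by right; exists n.+1 => //; apply/fsetP => x; rewrite !inE orbF.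
Qed.

(** The first element y leaves room for y - 1 further ones. *)
Lemma schreier1_rank : nrank_ge (in_family schreier1) oomega [::].
Proof.
suff fin j s : (forall x, x \in s -> (size s + j <= x)%N) ->
    nrank_ge (in_family schreier1) (ofin j) s.
  constructor; first by apply/nat_le_fsetP => x; rewrite !inE.
  move=> c n /lt_omega[j ->]; exists (maxn n j).+1; rewrite ltnS leq_maxl.
  split=> //; apply: fin => x; rewrite inE => /eqP->.
  by rewrite add1n ltnS leq_maxr.
elim: j s => [|j IH] s sj.
  constructor=> [|d m]; last by rewrite ltNge ozero_le.
  apply/nat_le_fsetP => x; rewrite !inE => /sj; rewrite addn0; apply: leq_trans.
  by rewrite card_fseq size_undup.
constructor.
  apply/nat_le_fsetP => x; rewrite !inE => /sj; apply: leq_trans.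
  by rewrite card_fseq (leq_trans (size_undup _))// leq_addr.
move=> c n; rewrite [ofin _]/= lt_osuccE => cj.
exists (maxn n (size s + j)).+1; rewrite ltnS leq_maxl; split=> //.
apply: (rank_ge_le cj); apply: IH => x; rewrite mem_rcons inE size_rcons addSn.
move=> /orP[/eqP->|/sj]; first by rewrite ltnS leq_maxr.
by rewrite addnS.
Qed.

Section ConvolutionPower.
Variable S : {fset nat} -> Prop.
Hypotheses (rS : regular S) (S1 : forall n, (0 < n)%N -> S [fset n]%fset).

Definition convolution_power n := iter n (labelled S) schreier0.

Lemma convolution_power_regular n : regular (convolution_power n).
Proof.
elim: n => [|n IH]; first exact: schreier0_regular.
exact: labelled_regular rS IH.
Qed.

Lemma schreier0_power n F : schreier0 F -> convolution_power n F.
Proof.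
elim: n F => // n IH F F0; exists id; split=> //.
  rewrite imfset_id; case: F0 => [->|[m m0 ->]]; last exact: S1.
  by apply: (regular_sub rS (S1 (isT : 0 < 1)%N)) => x; rewrite inE.
move=> v; apply: (regular_sub (@convolution_power_regular n) (IH F F0)) => x.
by rewrite in_fiber => /andP[].
Qed.

Lemma convolution_powerS n F : S F -> 0%N \notin F -> convolution_power n.+1 F.
Proof.
move=> SF F0; exists id; split=> //; first by rewrite imfset_id.
move=> v; apply: (@schreier0_power n).
have [->|[x]] := fset_0Vmem (fiber id F v); first by left.
rewrite in_fiber => /andP[xF /eqP xv]; right; exists v.
  by rewrite lt0n; apply: contraNneq F0 => <-; rewrite -xv.
by apply/fsetP => y; rewrite in_fiber inE andb_idl// => /eqP->; rewrite -xv.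
Qed.

End ConvolutionPower.

Section SchreierRank.
Variables (fs : cord -> nat -> cord) (hfs : fundamental_sequences fs).
Notation S := (schreier fs).

Lemma schreier_rank a : nrank_ge (in_family (S a)) (omegapow a) [::].
Proof.
elim/cord_ind: a => [|a IH|l ll IH].
- by rewrite schreier_0 omegapow0; apply: schreier0_rank.
- rewrite (schreier_succE hfs) omegapowS.
  exact: labelled_rank schreier1_regular (omegapow_gt0 a) IH _ schreier1_rank.
constructor.
  rewrite /in_family schreier_limit//; exists 0%N; split.
    exact: rank_ge_here (IH _ (fundamental_lt hfs 0 ll)).
  by apply/nat_le_fsetP => x; rewrite !inE.
move=> c n /(continuous_lt omegapow_continuous ll)[b /(fundamental_cofinal hfs ll)[i bi] cb].
have := nrank_ge_sorted i (IH _ (fundamental_lt hfs i ll)).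
move=> /(rank_ge_next n)/(_ (lt_trans cb (omegapow_lt bi)))[y [ny Py]].
exists y; split=> //; apply: rank_ge_sub Py => t [St ti].
rewrite /in_family schreier_limit//; exists i; split=> //.
by apply/nat_le_fsetP => x; rewrite !inE; apply: path_ltn_gt ti.
Qed.

Variable alpha : cord.

Lemma schreier_power_small (R : realType) n : (oone <= alpha)%O ->
  exists2 xi, (xi < omul alpha oomega)%O & small R (convolution_power (S alpha) n) xi.
Proof.
move=> alpha1; elim: n => [|n [xi xilt sxi]].
  exists oone; last exact: schreier0_small.
  apply: (le_lt_trans alpha1); rewrite -{1}(omul1 alpha).
  by apply: omul_lt (ofin_lt_omega 1); apply: lt_le_trans alpha1; exact: lt_osucc.
exists (oadd xi (osucc alpha)); first exact: omul_omega_add_lt.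
apply: small_labelled sxi; first exact: (schreier_regular hfs alpha).1.
exact: schreier_small.
Qed.

Lemma schreier_power_rank n :
  nrank_ge (in_family (convolution_power (S alpha) n)) (omegapow (omul alpha (ofin n))) [::].
Proof.
elim: n => [|n IH].
  by rewrite omul0 omegapow0; apply: schreier0_rank.
rewrite [ofin _]/= omulS omegapowD.
apply: labelled_rank (schreier_regular hfs alpha).1 (omegapow_gt0 _) IH _ _.
exact: schreier_rank.
Qed.

End SchreierRank.

(** * Finitely supported sequences *)

Section C00Lemmas.
Variable R : realType.
Implicit Types (x y : c00 R) (E F : {fset nat}).

Lemma c00D x y k : (x + y) k = x k + y k.
Proof. by rewrite -[c00_val (x + y)]/(val (x + y)) raddfD. Qed.

Lemma c00Z (a : R) x k : (a *: x) k = a * x k.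
Proof. by []. Qed.

Lemma c00_0 k : (0 : c00 R) k = 0.
Proof. by rewrite -[c00_val 0]/(val (0 : c00 R)) raddf0. Qed.

Lemma c00_sum I (r : seq I) (P : pred I) (f : I -> c00 R) k :
  (\sum_(i <- r | P i) f i) k = \sum_(i <- r | P i) f i k.
Proof. by elim/big_rec2: _ => [|i x y _ <-]; rewrite ?c00_0 ?c00D. Qed.

Lemma c00_ext x y : (forall k, x k = y k) -> x = y.
Proof. by move=> xy; apply: val_inj; apply/funext. Qed.

Lemma restrE E x k : c00_restr E x k = if k.+1 \in E then x k else 0.
Proof. by []. Qed.

Lemma restr_linear E : linear (c00_restr (R:=R) E).
Proof.
move=> a x y; apply: c00_ext => k; rewrite c00D c00Z !restrE c00D c00Z.
by case: ifP => //; rewrite mulr0 addr0.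
Qed.
HB.instance Definition _ E :=
  GRing.isLinear.Build R (c00 R) (c00 R) _ (c00_restr E) (restr_linear E).

Lemma restrC E F x : c00_restr E (c00_restr F x) = c00_restr F (c00_restr E x).
Proof. by apply: c00_ext => k; rewrite !restrE; case: ifP; case: ifP. Qed.

Lemma c00_bounded x : exists n, forall k, (n <= k)%N -> x k = 0.
Proof.
case: x => x /= /asboolP /finite_seqP[s sE].
exists (\max_(i <- s) i).+1 => k sk; apply: contrapT => xk.
have ks : k \in s by have : [set` s] k by rewrite -sE; apply/eqP.
by have := @leq_bigmax_seq _ s xpredT id k ks isT; rewrite leqNgt sk.
Qed.

Lemma c00_unit_expansion x n : (forall k, (n <= k)%N -> x k = 0) ->
  x = \sum_(k < n) x k *: c00_unit R k.
Proof.
move=> xn; apply: c00_ext => k; rewrite c00_sum.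
under eq_bigr do rewrite c00Z /=.
have [kn|nk] := ltnP k n; last first.
  rewrite xn// big1// => i _; rewrite [k == i]gtn_eqF ?mulr0//.
  exact: leq_trans (ltn_ord i) nk.
rewrite (bigD1 (Ordinal kn))//= eqxx mulr1 big1 ?addr0// => i.
by rewrite -val_eqE/= eq_sym => /negbTE->; rewrite mulr0.
Qed.

End C00Lemmas.

Lemma pairwise_fset_ltP (E : seq {fset nat}) F G : pairwise fset_lt E ->
  F \in E -> G \in E -> [\/ F = G, fset_lt F G | fset_lt G F].
Proof.
elim: E => //= H E IH /andP[/allP HE /IH{}IH].
rewrite !inE => /orP[/eqP->|FE] /orP[/eqP->|GE].
- by constructor 1.
- by constructor 2; apply: HE.
- by constructor 3; apply: HE.
- exact: IH.
Qed.

Lemma fset_ltP (F G : {fset nat}) x y : fset_lt F G -> x \in F -> y \in G -> (x < y)%N.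
Proof. by move=> /allrelP; apply. Qed.

Lemma pairwise_fset_lt_uniq (E : seq {fset nat}) : pairwise fset_lt E ->
  fset0 \notin E -> uniq E.
Proof.
elim: E => //= H E IH /andP[/allP HE /IH{}IH].
rewrite inE negb_or eq_sym => /andP[/fset0Pn[x xH] /IH ->]; rewrite andbT.
by apply/negP => /HE /fset_ltP/(_ xH xH); rewrite ltnn.
Qed.

Lemma pairwise_fset_lt_disj (E : seq {fset nat}) F G x : pairwise fset_lt E ->
  F \in E -> G \in E -> x \in F -> x \in G -> F = G.
Proof.
move=> pE FE GE xF xG; have [//|FG|GF] := pairwise_fset_ltP pE FE GE.
  by have := fset_ltP FG xF xG; rewrite ltnn.
by have := fset_ltP GF xG xF; rewrite ltnn.
Qed.

Lemma sum_at_most_one (R : realType) (T : eqType) (E : seq T) (P : T -> bool) (c : R) :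
  0 <= c -> uniq E -> (forall F G, F \in E -> G \in E -> P F -> P G -> F = G) ->
  \sum_(F <- E | P F) c <= c.
Proof.
move=> c0 uE PE; have [/hasP[F FE PF]|/hasPn nP] := boolP (has P E); last first.
  by rewrite big_seq_cond big1// => F /andP[/nP/negbTE->].
rewrite big_mkcond (bigD1_seq F)//= PF big_seq_cond big1 ?addr0// => G /andP[GE GF].
by case: ifP => // PG; move: GF; rewrite (PE G F) ?eqxx.
Qed.

Lemma seq_argmax (R : realType) (T : eqType) (s : seq T) (P : T -> Prop) (f : T -> R) :
  (exists2 x, x \in s & P x) ->
  exists2 x, x \in s /\ P x & forall y, y \in s -> P y -> f y <= f x.
Proof.
elim: s => [|a s IH]; first by case.
have [sP _|nsP] := pselect (exists2 x, x \in s & P x); last first.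
  move=> [x]; rewrite inE => /orP[/eqP->|xs] Px; last by case: nsP; exists x.
  exists a; first by rewrite mem_head.
  move=> y; rewrite inE => /orP[/eqP->//|ys] Py; by case: nsP; exists y.
have [x [xs Px] xmax] := IH sP.
have [[Pa fax]|na] := pselect (P a /\ f x <= f a).
  exists a; first by rewrite mem_head.
  move=> y; rewrite inE => /orP[/eqP->//|ys] Py; exact: le_trans (xmax y ys Py) fax.
exists x; first by rewrite inE xs orbT.
move=> y; rewrite inE => /orP[/eqP->|/xmax//] Pa.
by rewrite leNgt; apply/negP => /ltW fxa; apply: na.
Qed.

(** * The Tsirelson norm *)

Section Tsirelson.
Variables (R : realType) (S : set {fset nat}) (N : c00 R -> R).
Hypotheses (rS : regular S) (S1 : forall n, (0 < n)%N -> S [fset n]%fset).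
Hypothesis hN : tsirelson_norm S 2^-1 N.
Implicit Types (x y : c00 R) (E : seq {fset nat}) (F : {fset nat}).

Lemma tnormZ (a : R) x : N (a *: x) = `|a| * N x.
Proof. by case: hN => -[_ + _] _. Qed.

Lemma tnormD x y : N (x + y) <= N x + N y.
Proof. by case: hN => -[_ _ +] _. Qed.

Lemma tnorm0 : N 0 = 0.
Proof. by rewrite -(scale0r 0) tnormZ normr0 mul0r. Qed.

Lemma tnorm_ge0 x : 0 <= N x.
Proof.
have := tnormD x (- x); rewrite subrr tnorm0 -scaleN1r tnormZ normrN1 mul1r.
by lra.
Qed.

Lemma tnorm_sum I (r : seq I) (P : pred I) (f : I -> c00 R) :
  N (\sum_(i <- r | P i) f i) <= \sum_(i <- r | P i) N (f i).
Proof.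
elim/big_rec2: _ => [|i x y _ xy]; first by rewrite tnorm0.
by apply: le_trans (tnormD _ _) _; rewrite lerD2l.
Qed.

Lemma admissible_disj E F G p : admissible S E -> F \in E -> G \in E ->
  p \in F -> p \in G -> F = G.
Proof. by move=> [_ _ pE _]; apply: pairwise_fset_lt_disj. Qed.

Lemma admissible_uniq E : admissible S E -> uniq E.
Proof. by move=> [_ E0 pE _]; apply: pairwise_fset_lt_uniq. Qed.

Let sums x := [set \sum_(F <- E) N (c00_restr F x) | E in admissible S].

Let sums_nonempty x : sums x !=set0.
Proof.
exists (\sum_(F <- [:: [fset 1%N]%fset]) N (c00_restr F x)); exists [:: [fset 1%N]%fset] => //.
split=> //; first by rewrite inE; apply/eqP/fsetP => /(_ 1%N); rewrite !inE.
rewrite (_ : [fset _ | F in _]%fset = [fset 1%N]%fset); first exact: S1.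
apply/fsetP => v; rewrite inE; apply/imfsetP/eqP => /= [[F]|->].
  rewrite inE => /eqP-> ->; apply/eqP; rewrite -(in_fset1 1%N).
  by apply/fset_min_mem/(@mem_fset_neq0 _ 1%N); rewrite inE.
exists [fset 1%N]%fset; rewrite ?inE//; apply/esym/eqP; rewrite -(in_fset1 1%N).
by apply/fset_min_mem/(@mem_fset_neq0 _ 1%N); rewrite inE.
Qed.

(* The sets of an admissible sequence are disjoint, so each coordinate counts
at most once. *)
Let sums_bounded x : has_ubound (sums x).
Proof.
have [n xn] := c00_bounded x.
exists (\sum_(k < n) `|x k| * N (c00_unit R k)) => _ [E admE <-].
have term F : N (c00_restr F x) <=
    \sum_(k < n) if k.+1 \in F then `|x k| * N (c00_unit R k) else 0.
  rewrite [c00_restr F x](@c00_unit_expansion _ _ n) => [|k nk]; last first.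
    by rewrite restrE xn//; case: ifP.
  apply: le_trans (tnorm_sum _ _ _) _; apply: ler_sum => k _.
  by rewrite tnormZ restrE; case: ifP; rewrite // normr0 mul0r.
apply: le_trans (ler_sum _ (fun F _ => term F)) _.
rewrite exchange_big/=; apply: ler_sum => k _.
rewrite -big_mkcond; apply: sum_at_most_one => [||F G FE GE].
- by rewrite mulr_ge0// tnorm_ge0.
- exact: admissible_uniq.
- exact: (admissible_disj admE FE GE).
Qed.

Lemma tnorm_admissible E x : admissible S E ->
  \sum_(F <- E) N (c00_restr F x) <= 2 * N x.
Proof.
move=> admE; rewrite -ler_pdivrMl//; have [_ ->] := hN; rewrite le_max; apply/orP; right.
rewrite ler_pM2l ?invr_gt0//; apply: ub_le_sup; first exact: sums_bounded.
by exists E.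
Qed.

Lemma tnorm_coord x k : `|x k| <= N x.
Proof.
have [_ ->] := hN; rewrite le_max; apply/orP; left; apply: ub_le_sup; last by exists k.
have [n xn] := c00_bounded x.
exists (\sum_(i < n) `|x i|) => _ [i _ <-].
have [ni|i_n] := leqP n i; first by rewrite xn// normr0 sumr_ge0.
by rewrite (bigD1 (Ordinal i_n))//= lerDl sumr_ge0.
Qed.

Lemma tnorm_le x B : (forall k, `|x k| <= B) ->
  (forall E, admissible S E -> \sum_(F <- E) N (c00_restr F x) <= 2 * B) ->
  N x <= B.
Proof.
move=> xB sB; have [_ ->] := hN; rewrite ge_max; apply/andP; split.
  by apply: ge_sup => [|_ [k _ <-] //]; exists `|x 0%N|, 0%N.
rewrite ler_pdivrMl//; apply: ge_sup => [|_ [E admE <-]]; first exact: sums_nonempty.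
exact: sB.
Qed.

Lemma tnorm_unit k : N (c00_unit R k) = 1.
Proof.
apply/le_anti/andP; split; last first.
  by apply: le_trans (tnorm_coord _ k); rewrite /= eqxx normr1.
suff : N (c00_unit R k) <= Num.max 1 (N (c00_unit R k) / 2).
  by rewrite le_max => /orP[//|]; have := tnorm_ge0 (c00_unit R k); lra.
apply: tnorm_le => [i|E admE].
  by rewrite le_max /=; case: eqP; rewrite ?normr1 ?normr0 ?lexx ?ler01.
apply: le_trans (_ : N (c00_unit R k) <= _); last first.
  by rewrite -ler_pdivrMl// mulrC le_max lexx orbT.
apply: le_trans (_ : \sum_(F <- E | k.+1 \in F) N (c00_unit R k) <= _); last first.
  apply: sum_at_most_one (tnorm_ge0 _) (admissible_uniq admE) _ => F G FE GE.
  exact: (admissible_disj admE FE GE).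
rewrite [leRHS]big_mkcond; apply: ler_sum => F _; case: ifP => kF.
  suff -> : c00_restr F (c00_unit R k) = c00_unit R k by [].
  by apply: c00_ext => i; rewrite restrE/=; case: eqP => [->|]; rewrite ?kF//; case: ifP.
suff -> : c00_restr F (c00_unit R k) = 0 by rewrite tnorm0.
by apply: c00_ext => i; rewrite restrE c00_0/=; case: eqP => [->|]; rewrite ?kF//; case: ifP.
Qed.

(** The norm equation forces the basis to be monotone under restrictions: the
pieces of an admissible decomposition either have smaller support, or leave a
single term N x, which is then multiplied by 1/2. *)
Lemma tnorm_restr F x : N (c00_restr F x) <= N x.
Proof.
have [n xn] := c00_bounded x.
have supp k : x k != 0 -> k \in iota 0 n.
  by rewrite mem_iota/= add0n ltnNge; apply: contra => /xn ->.
move: supp {xn}; move: {2}(size _) (leqnn (size (iota 0 n))) => m.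
move: (iota 0 n) => s; elim: m s x F => [|m IH] s x F sm supp.
  have -> : x = 0.
    apply: c00_ext => k; rewrite c00_0; apply: contrapT => /eqP/supp.
    by move: sm; rewrite leqn0 size_eq0 => /eqP->.
  by rewrite linear0.
have [->//|xF] := eqVneq (c00_restr F x) x.
have [x0|x0] := eqVneq x 0; first by rewrite x0 linear0.
have [k xk] : exists k, x k != 0.
  apply: contrapT => nx; move/eqP: x0; apply; apply: c00_ext => k.
  by rewrite c00_0; apply: contrapT => /eqP xk; apply: nx; exists k.
suff : N (c00_restr F x) <= Num.max (N x) (N (c00_restr F x) / 2).
  by rewrite le_max => /orP[//|]; have := tnorm_ge0 (c00_restr F x);
     have := tnorm_ge0 x; lra.
apply: tnorm_le => [i|E admE].
  rewrite le_max; apply/orP; left; apply: le_trans (tnorm_coord x i).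
  by rewrite restrE; case: ifP; rewrite // normr0.
have [/hasP[G GE /eqP Gx]|/hasPn nG] := boolP (has (fun G => c00_restr G x == x) E).
  apply: le_trans (_ : N (c00_restr F x) <= _); last first.
    by rewrite -ler_pdivrMl// mulrC le_max lexx orbT.
  have suppG p : x p != 0 -> p.+1 \in G.
    by rewrite -Gx restrE; case: ifP => //; rewrite eqxx.
  rewrite (bigD1_seq G)//=; last exact: admissible_uniq.
  rewrite restrC Gx big_seq_cond big1 ?addr0// => H /andP[HE HG].
  suff -> : c00_restr H (c00_restr F x) = 0 by rewrite tnorm0.
  apply: c00_ext => p; rewrite !restrE c00_0; case: ifP => // pH; case: ifP => // _.
  apply: contrapT => /eqP/suppG pG; move/eqP: HG; apply.
  exact: admissible_disj admE HE GE pH pG.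
apply: le_trans (_ : 2 * N x <= _); last by rewrite ler_pM2l// le_max lexx.
apply: le_trans (tnorm_admissible x admE).
rewrite big_seq [leRHS]big_seq; apply: ler_sum => G /nG Gx; rewrite restrC.
have [p xp pG] : exists2 p, x p != 0 & p.+1 \notin G.
  apply: contrapT => np; move/eqP: Gx; apply; apply: c00_ext => p; rewrite restrE.
  case: ifPn => // pG; apply: contrapT => /eqP; rewrite eq_sym => xp.
  by apply: np; exists p.
apply: (IH (rem p s)) => [|q].
  by rewrite size_rem ?supp// -ltnS prednK//; case: (s) (supp p xp).
rewrite restrE; case: ifPn => [qG /supp qs|]; last by rewrite eqxx.
have : q != p by apply: contraTneq qG => ->.
by move=> /rem_mem; apply.
Qed.

(** Each of the n convolutions is one use of the norm equation: the pieces of a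
member of S[S^n] form an admissible sequence. *)
Lemma tnorm_convolution_power n G x m : convolution_power S n G ->
  2^-1 ^+ n * (\sum_(k < m | k.+1 \in G) `|x k|) <= N x.
Proof.
elim: n G x => [|n IH] G x.
  rewrite expr0 mul1r => -[->|[[//|p] _ ->]].
    by rewrite big1 ?tnorm_ge0// => k; rewrite inE.
  have [pm|mp] := ltnP p m.
    rewrite (bigD1 (Ordinal pm)) ?inE//= big1 ?addr0 ?tnorm_coord// => k.
    by rewrite inE eqSS => /andP[/eqP kp]; rewrite -val_eqE/= kp eqxx.
  rewrite big1 ?tnorm_ge0// => k; rewrite inE eqSS => /eqP kp.
  by move: (ltn_ord k); rewrite kp ltnNge mp.
move=> [f [fle fmono Sf Pf]].
pose V := [fset f p | p in G]%fset; pose E := [seq fiber f G v | v <- sort leq V].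
have VP v : v \in V -> exists2 p, p \in G & v = f p by move=> /imfsetP[/= p]; exists p.
have [V0|V0] := eqVneq V fset0.
  rewrite big1 ?mulr0 ?tnorm_ge0// => k kG.
  by have : f k.+1 \in V by [apply/imfsetP; exists k.+1]; rewrite V0 inE.
have vsV v : (v \in sort leq V) = (v \in V) by rewrite mem_sort.
have vslt : sorted ltn (sort leq V).
  by rewrite ltn_sorted_uniq_leq sort_uniq fset_uniq/= (sort_sorted leq_total).
have EP F : F \in E -> exists2 v, v \in V & F = fiber f G v.
  by move=> /mapP[v]; rewrite vsV; exists v.
have fib0 v : v \in V -> fiber f G v != fset0.
  by move=> /VP[p pG ->]; apply: (@mem_fset_neq0 _ p); rewrite in_fiber pG eqxx.
have minP v : v \in V -> fset_min (fiber f G v) \in G /\ f (fset_min (fiber f G v)) = v.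
  by move/fib0/fset_min_mem; rewrite in_fiber => /andP[? /eqP].
have admE : admissible S E.
  split.
  - have /fset0Pn[v vV] := V0; apply/eqP => E0.
    have : fiber f G v \in E by apply: map_f; rewrite vsV.
    by rewrite E0.
  - by apply/negP => /EP[v /fib0 /negP + E0]; rewrite -E0.
  - rewrite pairwise_map; move: vslt; rewrite (sorted_pairwise ltn_trans).
    apply: sub_pairwise => v w vw; apply/allrelP => p q; rewrite !in_fiber.
    move=> /andP[pG /eqP fp] /andP[qG /eqP fq]; have [//|qp] := ltnP p q.
    by have := fmono _ _ qG pG qp; rewrite fp fq leqNgt (vw : (v < w)%N).
  - apply: (@rS _ _ f Sf) => [p /imfsetP[/= F /EP[v vV ->] ->]|].
      by have [mG fm] := minP v vV; have := fle _ mG; rewrite fm.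
    move=> p q /imfsetP[/= F /EP[v vV ->] ->] /imfsetP[/= F' /EP[w wV ->] ->] pq.
    have [vG fv] := minP v vV; have [wG fw] := minP w wV; rewrite fv fw.
    have := fmono _ _ vG wG (ltnW pq); rewrite fv fw leq_eqVlt => /orP[/eqP vw|//].
    by rewrite vw ltnn in pq.
have e0 : 0 < 2^-1 ^+ n :> R by rewrite exprn_gt0// invr_gt0.
rewrite exprS -mulrA ler_pdivrMl//; apply: le_trans (tnorm_admissible x admE).
apply: le_trans (_ : \sum_(F <- E) 2^-1 ^+ n * (\sum_(k < m | k.+1 \in F) `|x k|) <= _); last first.
  rewrite big_seq [leRHS]big_seq; apply: ler_sum => F FE.
  have [v vV FV] := EP F FE; apply: le_trans (IH F (c00_restr F x) _); last first.
    by rewrite FV; apply: Pf.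
  by rewrite ler_pM2l// ler_sum// => k kF; rewrite restrE kF.
rewrite -mulr_sumr ler_pM2l// big_map.
under [leRHS]eq_bigr do rewrite big_mkcond.
rewrite exchange_big/= big_mkcond; apply: ler_sum => k _.
case: ifPn => [kG|_]; last by apply: sumr_ge0 => v _; case: ifP.
have kV : f k.+1 \in sort leq V by rewrite vsV; apply/imfsetP; exists k.+1.
have uV : uniq (sort leq V) by rewrite sort_uniq fset_uniq.
rewrite (bigD1_seq (f k.+1) kV uV) in_fiber kG eqxx lerDl.
by apply: sumr_ge0 => v _; case: ifP.
Qed.

(** The vectors z q, q in t, are successive blocks; q bounds the support of z q
and lies to the left of the supports of the later ones.  Sets of blocks are thus
sets of integers, which can be compared with S.  Coordinate k stands for the
basis vector e_(k+1). *)
Section BlockUpperEstimate.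
Hypothesis S0 : forall F, S F -> 0%N \notin F.
Implicit Types (J : {fset nat}) (q : nat).
Variables (t : seq nat) (z : nat -> c00 R) (a : nat -> R) (B : R).
Hypotheses (ut : uniq t) (t0 : forall q, q \in t -> (0 < q)%N).
Hypotheses (a0 : forall q, 0 <= a q) (zB : forall q, q \in t -> N (z q) <= B).
Hypothesis zt : forall q k, q \in t -> z q k != 0 ->
  (k < q)%N /\ forall p, p \in t -> (p < q)%N -> (p <= k)%N.

Let X (J : {fset nat}) : c00 R := \sum_(q <- t | q \in J) a q *: z q.
Let wt := mass a t.
Let meets (F : {fset nat}) q := `[< exists2 k, k.+1 \in F & z q k != 0 >].
Let T := [fset q in t]%fset.

Let meetsN F q : ~~ meets F q -> c00_restr F (z q) = 0.
Proof.
move=> nm; apply: c00_ext => k; rewrite restrE c00_0; case: ifP => // kF.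
by apply: contrapT => /eqP zk; move/asboolP: nm; apply; exists k.
Qed.

Let meets_min F q : q \in t -> meets F q -> (fset_min F <= q)%N.
Proof.
move=> qt /asboolP[k kF zk]; apply: leq_trans (fset_min_le kF) _.
exact: (zt qt zk).1.
Qed.

Let B0 q : q \in t -> 0 <= B.
Proof. by move=> /zB; apply: le_trans; apply: tnorm_ge0. Qed.

Let mass0 J : 0 <= wt J. Proof. exact: mass_ge0. Qed.

(** The blocks that meet F and no other set of E, and those that meet at least
two sets of E. *)
Let inside (E : seq {fset nat}) (J F : {fset nat}) : {fset nat} :=
  [fset q in J | [&& q \in t, meets F q & all (fun F' => meets F' q ==> (F' == F)) E]]%fset.
Let split (E : seq {fset nat}) (J : {fset nat}) : {fset nat} :=
  [fset q in J | (q \in t) && has (fun F => has (fun F' => [&& fset_lt F F', meets F q & meets F' q]) E) E]%fset.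

Let insideP E J F q : reflect [/\ q \in J, q \in t, meets F q
    & forall F', F' \in E -> meets F' q -> F' = F] (q \in inside E J F).
Proof.
have -> : (q \in inside E J F) =
    [&& q \in J, q \in t, meets F q & all (fun F' => meets F' q ==> (F' == F)) E].
  by rewrite in_fset inE.
apply: (iffP and4P) => [[qJ qt m /allP h]|[qJ qt m h]]; split; try assumption.
  by move=> F' F'E m'; apply/eqP; have /implyP := h _ F'E; apply.
by apply/allP => F' F'E; apply/implyP => m'; apply/eqP/h.
Qed.

Let splitP E J q : reflect (exists F F', [/\ q \in J, q \in t & [/\ F \in E,
    F' \in E, fset_lt F F', meets F q & meets F' q]]) (q \in split E J).
Proof.
have -> : (q \in split E J) = [&& q \in J, q \in t & has (fun F =>
    has (fun F' => [&& fset_lt F F', meets F q & meets F' q]) E) E].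
  by rewrite in_fset inE.
apply: (iffP and3P) => [[qJ qt /hasP[F FE /hasP[F' F'E /and3P[FF' m m']]]]|].
  by exists F, F'; split; try assumption; split.
move=> [F [F' [qJ qt [FE F'E FF' m m']]]]; split; try assumption.
by apply/hasP; exists F => //; apply/hasP; exists F' => //; rewrite FF' m.
Qed.

(* A split block contains in its support range the minimum of the later of two
sets that it meets.  These minima increase with the block. *)
Let split_S E J : admissible S E -> S (split E J).
Proof.
move=> [_ E0 pE SE].
have ch q : exists F', q \in split E J -> exists F, [/\ q \in t, F \in E, F' \in E
    & [/\ fset_lt F F', meets F q & meets F' q]].
  have [/splitP[F [F' [_ qt [FE F'E FF' m m']]]]|_] := boolP (q \in split E J).
    by exists F' => _; exists F.
  by exists fset0.
have [g gP] := choice ch.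
have F0 F : F \in E -> F != fset0 by apply: contraTneq => ->.
apply: (@rS _ _ (fun q => fset_min (g q)) SE) => [q /gP[F [qt _ gE [_ _ m]]]|p q].
  by split; [apply/imfsetP; exists (g q)|apply: meets_min].
move=> /gP[F [pt _ _ [_ _ m]]] /gP[F' [qt _ gE [lt /asboolP[k kF zk] _]]] pq.
apply: leq_ltn_trans (meets_min pt m) _.
have := fset_ltP lt kF (fset_min_mem (F0 _ gE)); apply: leq_trans.
by rewrite ltnS; apply/leqW/(zt qt zk).2.
Qed.

Let inside_disj E J F F' q : F \in E -> F' \in E -> q \in inside E J F ->
  q \in inside E J F' -> F = F'.
Proof. by move=> FE F'E /insideP[_ _ m _] /insideP[_ _ _]; apply. Qed.

Let split_inside E J F q : admissible S E -> F \in E -> q \in split E J ->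
  q \notin inside E J F.
Proof.
move=> [_ E0 _ _] FE /splitP[G [G' [_ _ [GE G'E GG' m m']]]].
apply/negP => /insideP[_ _ _ h].
move: GG'; rewrite (h _ GE m) (h _ G'E m') => FF.
have /fset0Pn[x xF] : F != fset0 by apply: contraTneq FE => ->.
by have := fset_ltP FF xF xF; rewrite ltnn.
Qed.

(* A block that is not split contributes to the restriction to F only if F is
the unique set which it meets. *)
Let restr_split E J F : admissible S E -> F \in E ->
  c00_restr F (X J) = c00_restr F (X (inside E J F)) +
    \sum_(q <- t | q \in split E J) a q *: c00_restr F (z q).
Proof.
move=> admE FE; have [_ E0 pE _] := admE.
rewrite !linear_sum/= (big_mkcond (fun q => q \in J)) (big_mkcond (fun q => q \in inside E J F)).
rewrite (big_mkcond (fun q => q \in split E J)) -big_split/= big_seq [RHS]big_seq.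
apply: eq_bigr => q qt.
have [qJ|qJ] := boolP (q \in J); last first.
  rewrite ifN; last by apply: contra qJ => /insideP[].
  by rewrite ifN ?addr0//; apply: contra qJ => /splitP[? [? []]].
rewrite !linearZ/=.
have [qs|qs] := boolP (q \in split E J).
  by rewrite (negbTE (split_inside admE FE qs)) add0r.
rewrite addr0; have [//|qi] := boolP (q \in inside E J F).
have [m|/meetsN->] := boolP (meets F q); last by rewrite scaler0.
exfalso; move/negP: qi; apply; apply/insideP; split=> // F' F'E m'.
have [//|lt|lt] := pairwise_fset_ltP pE F'E FE; move/negP: qs; case; apply/splitP.
  by exists F', F.
by exists F, F'.
Qed.

(** Labelling the elements of G F by min F exhibits the union as a member of
S[M]. *)
Let inside_union E J (M : {fset nat} -> Prop) (G : {fset nat} -> {fset nat}) :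
  admissible S E -> regular M -> (forall F, M (G F)) ->
  (forall F, {subset G F <= inside E J F}) ->
  labelled S M [fset q in T | has (fun F => q \in G F) E]%fset.
Proof.
move=> [E1 E0 pE SE] rM MG GJ.
set U := [fset q in T | _]%fset.
have UP q : q \in U -> q \in t /\ exists2 F, F \in E & q \in G F.
  by rewrite !inE => /andP[qt /hasP[F FE qF]]; split=> //; exists F.
have F0 F : F \in E -> F != fset0 by apply: contraTneq => ->.
have ch q : exists F, q \in U -> F \in E /\ q \in G F.
  have [/UP[_ [F FE qF]]|_] := boolP (q \in U); first by exists F.
  by exists fset0.
have [g gP] := choice ch.
have mlt F F' : F \in E -> F' \in E -> fset_lt F F' -> (fset_min F < fset_min F')%N.
  by move=> FE F'E lt; apply: fset_ltP lt (fset_min_mem _) (fset_min_mem _); apply: F0.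
exists (fun q => fset_min (g q)); split.
- move=> q /gP[gE /GJ/insideP[_ qt m _]]; exact: meets_min.
- move=> p q pU qU; rewrite leq_eqVlt => /orP[/eqP->//|pq].
  have [gpE /GJ/insideP[_ pt /asboolP[k kp zk] _]] := gP p pU.
  have [gqE /GJ/insideP[_ qt /asboolP[l lq zl] _]] := gP q qU.
  have [->//|lt|lt] := pairwise_fset_ltP pE gpE gqE; first exact/ltnW/mlt.
  have := fset_ltP lt lq kp; rewrite ltnS => lk.
  have := ltn_trans lk (leq_trans (zt pt zk).1 ((zt qt zl).2 p pt pq)).
  by rewrite ltnn.
- apply: (regular_sub rS SE) => v /imfsetP[/= q /gP[gE _] ->].
  by apply/imfsetP; exists (g q).
- move=> v; have [->|[q]] := fset_0Vmem (fiber (fun q => fset_min (g q)) U v).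
    by apply: (regular_sub rM (MG fset0)) => x; rewrite inE.
  rewrite in_fiber => /andP[qU /eqP qv]; have [gqE _] := gP q qU.
  apply: (regular_sub rM (MG (g q))) => p.
  rewrite in_fiber => /andP[pU /eqP pv]; have [gpE pG] := gP p pU.
  suff -> : g q = g p by [].
  have [//|/mlt|/mlt] := pairwise_fset_ltP pE gqE gpE => [/(_ gqE gpE)|/(_ gpE gqE)];
  by rewrite pv qv ltnn.
Qed.

(** For an admissible E, the split blocks form a member of S and contribute at
most 2 B times their mass before the factor 1/2 of the norm equation is applied;
the others fall into the sets of E and are estimated by induction with this
factor gained.  The resulting sets for k are glued to a set for k + 1.  The set G is
chosen of maximal mass so as not to depend on E. *)
Lemma tnorm_blocks k J : exists G, [/\ convolution_power S k G, {subset G <= J}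
  & N (X J) <= B * (2^-1 ^+ k * wt J + k%:R * wt G)].
Proof.
have [t_nil|[q0 q0t]] : (t = [::]) + {q | q \in t}.
  case: (t) => [|q l]; [by left|right; exists q; exact: mem_head].
  exists fset0; split=> [|x|]; [|by rewrite inE|].
    by apply: schreier0_power => //; left.
  by rewrite /X /wt /mass t_nil !big_nil tnorm0 !mulr0 addr0 mulr0.
have Bge0 := B0 q0t.
elim: k J => [|k IH] J.
  exists fset0; split=> [|x|]; [by left|by rewrite inE|].
  rewrite expr0 mul1r mul0r addr0; apply: le_trans (tnorm_sum _ _ _) _.
  rewrite /wt /mass mulr_sumr big_seq_cond [leRHS]big_seq_cond.
  apply: ler_sum => q /andP[qt _].
  by rewrite tnormZ ger0_norm// mulrC ler_wpM2r// zB.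
have [|G [GJ PG] Gmax] := @seq_argmax R _ (fpowerset (J `&` T)%fset)
  (convolution_power S k.+1) wt.
  exists fset0; first by rewrite fpowersetE fsub0set.
  by apply: schreier0_power => //; left.
move: GJ; rewrite fpowersetE => /fsubsetP GJ.
have {}Gmax H : {subset H <= J} -> {subset H <= t} -> convolution_power S k.+1 H ->
    wt H <= wt G.
  move=> HJ Ht PH; apply: Gmax => //; rewrite fpowersetE; apply/fsubsetP => q qH.
  by rewrite !inE HJ// Ht.
exists G; split=> // [q /GJ|]; first by rewrite !inE => /andP[].
apply: tnorm_le => [l|E admE].
  apply: le_trans (_ : B * wt G <= _); last first.
    rewrite ler_wpM2l// -[k.+1%:R]natr1 mulrDl mul1r addrA lerDr.
    by rewrite addr_ge0// mulr_ge0// exprn_ge0// invr_ge0.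
  have [/hasP[q qt /andP[qJ zq]]|/hasPn nq] := boolP (has (fun q => (q \in J) && (z q l != 0)) t); last first.
    rewrite c00_sum big_seq_cond big1 ?normr0 ?mulr_ge0// => q /andP[/nq qn qJ].
    by rewrite c00Z; move: qn; rewrite qJ/= negbK => /eqP->; rewrite mulr0.
  have -> : X J l = a q * z q l.
    rewrite c00_sum; under eq_bigr do rewrite c00Z.
    rewrite big_mkcond (bigD1_seq q)//= qJ big_seq_cond big1 ?addr0// => p.
    case/andP=> pt pq; case: ifP => // _; have [->|zp] := eqVneq (z p l) 0; first by rewrite mulr0.
    have [lq qmin] := zt qt zq; have [lp pmin] := zt pt zp.
    have [pq'|qp'|pq'] := ltngtP p q; last by rewrite pq' eqxx in pq.
      by have := leq_trans lp (qmin p pt pq'); rewrite ltnn.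
    by have := leq_trans lq (pmin q qt qp'); rewrite ltnn.
  rewrite normrM ger0_norm// mulrC.
  have -> : a q = wt [fset q]%fset.
    rewrite /wt /mass big_mkcond (bigD1_seq q)//= inE eqxx big1 ?addr0// => p.
    by rewrite inE => /negbTE->.
  apply: ler_pM => //; first exact: le_trans (tnorm_coord _ _) (zB qt).
  apply: Gmax => [p|p|]; rewrite ?inE; [by move/eqP->|by move/eqP->|].
  by apply: schreier0_power => //; right; exists q => //; apply: t0.
have [g gP] := choice (fun F => IH (inside E J F)).
pose U := [fset q in T | has (fun F => q \in g F) E]%fset.
have UG : wt U <= wt G.
  apply: Gmax => [q|q|].
  - rewrite !inE => /andP[_ /hasP[F FE]]; have [_ gs _] := gP F.
    by move=> /gs/insideP[].
  - by rewrite !inE => /andP[].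
  - apply: (inside_union (J := J) admE) => [|F|F].
    + exact: convolution_power_regular.
    + by have [] := gP F.
    + by have [] := gP F.
have SG : wt (split E J) <= wt G.
  have sS := split_S J admE.
  apply: Gmax => [q /splitP[? [? []]]//|q /splitP[? [? []]]//|].
  by apply: convolution_powerS => //; apply: S0.
have uE := admissible_uniq admE.
have massI : \sum_(F <- E) wt (inside E J F) <= wt J.
  rewrite /wt /mass; under eq_bigr do rewrite big_mkcond.
  rewrite exchange_big/= [leRHS]big_mkcond; apply: ler_sum => q _; rewrite -big_mkcond.
  case: ifPn => [_|qJ]; last by rewrite big1// => F /insideP[]; rewrite (negbTE qJ).
  by apply: sum_at_most_one => // F F' FE F'E; apply: inside_disj.
have massU : \sum_(F <- E) wt (g F) <= wt U.
  rewrite /wt /mass; under eq_bigr do rewrite big_mkcond.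
  rewrite exchange_big/= [leRHS]big_mkcond big_seq [leRHS]big_seq.
  apply: ler_sum => q qt; rewrite -big_mkcond.
  case: ifPn => [_|qU]; last first.
    rewrite big_seq_cond big1// => F /andP[FE qF]; move/negP: qU; case.
    by rewrite !inE qt; apply/hasP; exists F.
  apply: sum_at_most_one => // F F' FE F'E.
  have [_ gs _] := gP F; have [_ gs' _] := gP F'.
  by move=> /gs qF /gs' qF'; apply: inside_disj qF qF'.
apply: le_trans (_ : \sum_(F <- E) (N (X (inside E J F)) +
    \sum_(q <- t | q \in split E J) a q * N (c00_restr F (z q))) <= _).
  rewrite big_seq [leRHS]big_seq; apply: ler_sum => F FE; rewrite (restr_split J admE FE).
  apply: le_trans (tnormD _ _) _; apply: lerD; first exact: tnorm_restr.
  apply: le_trans (tnorm_sum _ _ _) _; apply: ler_sum => q _.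
  by rewrite tnormZ ger0_norm.
rewrite big_split/= exchange_big/=.
have splitB : \sum_(q <- t | q \in split E J) \sum_(F <- E) a q * N (c00_restr F (z q)) <=
    2 * B * wt G.
  apply: le_trans (_ : 2 * B * wt (split E J) <= _); last by rewrite ler_wpM2l// mulr_ge0.
  rewrite /wt /mass mulr_sumr big_seq_cond [leRHS]big_seq_cond.
  apply: ler_sum => q /andP[qt _]; rewrite -mulr_sumr mulrC ler_wpM2r//.
  by apply: le_trans (tnorm_admissible _ admE) _; rewrite ler_wpM2l// zB.
have insB : \sum_(F <- E) N (X (inside E J F)) <=
    B * (2^-1 ^+ k * wt J + k%:R * wt G).
  apply: le_trans (_ : \sum_(F <- E) B * (2^-1 ^+ k * wt (inside E J F) +
      k%:R * wt (g F)) <= _).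
    by apply: ler_sum => F _; have [] := gP F.
  rewrite -mulr_sumr ler_wpM2l// big_split/= -!mulr_sumr lerD// ler_wpM2l//.
    by rewrite exprn_ge0// invr_ge0.
  exact: le_trans UG.
apply: le_trans (lerD insB splitB) _; rewrite exprS -[k.+1%:R]natr1.
have kG : 0 <= k%:R * (B * wt G) by rewrite mulr_ge0// mulr_ge0.
have -> : 2 * (B * (2^-1 * 2^-1 ^+ k * wt J + (k%:R + 1) * wt G)) =
  B * (2^-1 ^+ k * wt J + k%:R * wt G) + 2 * B * wt G + k%:R * (B * wt G).
  by field.
by rewrite lerDl.
Qed.

End BlockUpperEstimate.

End Tsirelson.

(** * Orders of trees and ranks of nodes *)

Section TreeOrder.
Variable X : eqType.
Implicit Types (T : set (seq X)) (P : seq X -> Prop) (s r : seq X).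

Definition xrank_ge := @rank_ge X (fun _ _ => True).

(** Trees need not contain the initial segments of their nodes. *)
Definition prefix_closure T s : Prop := exists r, T (s ++ r).

Lemma derived_tree_iter_le T a b : (a <= b)%O ->
  derived_tree_iter T b `<=` derived_tree_iter T a.
Proof.
elim/cord_ind: b => [|b IH|l ll IH].
- by move=> a0; rewrite (le_anti (introT andP (conj a0 (ozero_le a)))).
- rewrite le_eqVlt => /orP[/eqP->//|]; rewrite lt_osuccE => /IH ab.
  by rewrite derived_tree_iterS => s [/ab].
- rewrite le_eqVlt => /orP[/eqP->//|al].
  by rewrite derived_tree_iter_limit// => s; apply.
Qed.

Lemma xrank_ge_prefix P g s r : (forall u v, P (u ++ v) -> P u) ->
  xrank_ge P g (s ++ r) -> xrank_ge P g s.
Proof.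
move=> Pp; elim/(well_founded_ind cord_lt_wf): g s r => g IH s [|y r].
  by rewrite cats0.
move=> Pg; constructor; first exact: Pp (rank_ge_here Pg).
move=> b n bg; have [w [_ Pw]] := rank_ge_next n Pg bg.
exists y; split=> //; apply: (IH b bg _ (rcons r w)).
by rewrite cat_rcons -rcons_cons -rcons_cat.
Qed.

(** The node t extending s may be longer by several entries; its first new entry
has at least the rank of t. *)
Lemma derived_tree_rank T g s : derived_tree_iter T g s ->
  xrank_ge (prefix_closure T) g s.
Proof.
elim/(well_founded_ind cord_lt_wf): g s => g IH s Tg; constructor.
  exists [::]; rewrite cats0; have := derived_tree_iter_le (ozero_le g) Tg.
  by rewrite derived_tree_iter0.
move=> b n bg.
have : derived_tree_iter T (osucc b) s.
  by apply: derived_tree_iter_le Tg; rewrite cord_succ_ltP.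
rewrite derived_tree_iterS => -[_ [t Tt /andP[/prefixP[r tE] st]]].
case: r tE => [|y r] tE; first by rewrite tE cats0 eqxx in st.
exists y; split=> //; apply: (@xrank_ge_prefix _ _ _ r).
  by move=> u v [w Tw]; exists (v ++ w); rewrite catA.
by rewrite cat_rcons -tE; apply: IH.
Qed.

Lemma tree_order_le T g : ~ xrank_ge (prefix_closure T) g [::] ->
  (tree_order T <= Countable_ord g)%O.
Proof.
move=> nT; apply: xinf_le; exists g => //; rewrite /=.
apply/seteqP; split=> // s /derived_tree_rank Ts; apply: nT.
apply: (@xrank_ge_prefix _ _ _ s) => // u v [w Tw].
by exists (v ++ w); rewrite catA.
Qed.

(** The empty sequence is the root for [nrank_ge] but not a node of a tree on X,
which is harmless: its rank is a supremum over its successors. *)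
Lemma rank_tree_order (f : nat -> X) (Q : seq nat -> Prop) g :
  nrank_ge Q g [::] ->
  (Countable_ord g <= tree_order [set map f s | s in [set s | Q s /\ s <> [::]]])%O.
Proof.
move=> Qg; set T := [set _ | _ in _].
have QT b (s : seq nat) : s <> [::] -> nrank_ge Q b s -> derived_tree_iter T b (map f s).
  elim/cord_ind: b s => [|b IH|l ll IH] s s0 Qb.
  - by rewrite derived_tree_iter0; exists s => //; split=> //; apply: rank_ge_here Qb.
  - rewrite derived_tree_iterS; split.
      by apply: IH => //; apply: rank_ge_le Qb; apply/ltW/lt_osucc.
    have [y [_ Qy]] := rank_ge_next 0%N Qb (lt_osucc b).
    exists (map f (rcons s y)); first by apply: IH Qy; case: (s).
    rewrite /extends map_rcons prefix_rcons; apply/eqP => /(congr1 size).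
    by rewrite size_rcons => /n_Sn.
  - rewrite derived_tree_iter_limit// => b bl; apply: IH => //.
    by apply: rank_ge_le Qb; apply: ltW.
apply: xinf_glb => _ [a Ta <-]; suff : (g <= a)%O by [].
rewrite leNgt; apply/negP => ag.
have [y [_ Qy]] := rank_ge_next 0%N Qg ag.
by have : derived_tree_iter T a (map f [:: y]) by [apply: QT Qy]; rewrite Ta.
Qed.

End TreeOrder.

(** * From l_1-trees to block sequences *)

Section Comb.
Variables (R : realType) (V : lmodType R).

Definition comb (c : nat -> R) (s : seq V) : V := \sum_(i < size s) c i *: s`_i.

Lemma comb_cat c (s u : seq V) :
  comb c (s ++ u) = comb c s + comb (fun i => c (size s + i)%N) u.
Proof.
rewrite /comb size_cat big_split_ord; congr (_ + _); apply: eq_bigr => i _ /=.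
  by rewrite nth_cat ltn_ord.
by rewrite nth_cat ltnNge leq_addr addKn.
Qed.

Lemma eq_comb c d (s : seq V) : (forall i, (i < size s)%N -> c i = d i) ->
  comb c s = comb d s.
Proof. by move=> cd; apply: eq_bigr => i _; rewrite cd. Qed.

Definition l1norm (c : nat -> R) (s : seq V) : R := \sum_(i < size s) `|c i|.

Lemma l1norm_cat c (s u : seq V) :
  l1norm c (s ++ u) = l1norm c s + l1norm (fun i => c (size s + i)%N) u.
Proof. by rewrite /l1norm size_cat big_split_ord. Qed.

Lemma eq_l1norm c d (s : seq V) : (forall i, (i < size s)%N -> c i = d i) ->
  l1norm c s = l1norm d s.
Proof. by move=> cd; apply: eq_bigr => i _; rewrite cd. Qed.

End Comb.

(** There is one more vector than there are coordinates to be killed. *)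
Lemma kernel_combination (R : realType) (d : nat) (v : nat -> c00 R) :
  exists b : nat -> R, \sum_(i < d.+1) `|b i| = 1 /\
    forall k, (k < d)%N -> (\sum_(i < d.+1) b i *: v i) k = 0.
Proof.
pose A : 'M[R]_(d.+1, d) := \matrix_(i, k) v i k.
have kA : kermx A != 0.
  rewrite kermx_eq0 /row_free neq_ltn; apply/orP; left.
  by rewrite ltnS; apply: rank_leq_col.
have [i0 ui0] : exists i0, row i0 (kermx A) != 0.
  apply: contrapT => nr; move/eqP: kA; apply; apply/row_matrixP => i.
  by rewrite row0; apply: contrapT => /eqP ri; apply: nr; exists i.
set u := row i0 (kermx A) in ui0.
have uA : u *m A = 0 by rewrite -row_mul mulmx_ker row0.
pose s := \sum_(i < d.+1) `|u 0 i|.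
have s0 : 0 < s.
  rewrite lt_neqAle sumr_ge0// andbT eq_sym; apply: contra ui0.
  rewrite psumr_eq0// => /allP h; apply/eqP/rowP => i; rewrite [RHS]mxE.
  by apply/eqP; rewrite -normr_eq0; apply: h; rewrite mem_index_enum.
exists (fun i => u 0 (inord i) / s); split.
  under eq_bigr => i _ do rewrite inord_val normrM normfV (gtr0_norm s0).
  by rewrite -mulr_suml divff// gt_eqF.
move=> k kd; rewrite c00_sum; under eq_bigr => i _ do rewrite c00Z inord_val mulrAC.
rewrite -mulr_suml; have /rowP/(_ (Ordinal kd)) := uA.
rewrite !mxE => eq0; under eq_bigr => i _.
  have -> : u 0 i * v i k = u 0 i * A i (Ordinal kd) by rewrite !mxE.
  over.
by rewrite eq0 mul0r.
Qed.

Lemma rank_ge_steps (Y : Type) (C : nat -> Y -> Prop) (P : seq Y -> Prop) s n :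
  rank_ge C P (ofin n) s -> exists u, size u = n /\ P (s ++ u).
Proof.
elim: n s => [|n IH] s Pn.
  by exists [::]; rewrite cats0; split=> //; apply: rank_ge_here Pn.
have [y [_ /IH[u [un Pu]]]] := rank_ge_next 0%N Pn (lt_osucc _).
by exists (y :: u); rewrite -cat_rcons /= un.
Qed.

Section BlockReduction.
Variables (R : realType) (N : c00 R -> R) (X : completeNormedModType R).
Variable iota : {linear c00 R -> X}.
Hypothesis hX : is_completion N iota.
Variables (T : set (seq X)) (kappa : R).
Hypothesis kappa0 : 0 < kappa.
Hypothesis Tunit : forall s, prefix_closure T s -> forall x, x \in s -> `|x| = 1.
Hypothesis Tl1 : forall s, prefix_closure T s ->
  forall c, kappa * l1norm c s <= `|comb c s|.

Let approx (eta : R) (x : X) : 0 < eta -> exists v, `|x - iota v| <= eta.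
Proof.
move=> eta0; have [_ dense] := hX.
have : closure (range iota) x by rewrite dense.
move=> /(_ (ball x eta) (nbhsx_ballx x eta eta0))[_ [[v _ <-]]].
by rewrite -ball_normE /= => /ltW; exists v.
Qed.

Definition blocks_of (t : seq nat) (z : nat -> c00 R) : Prop :=
  [/\ path ltn 0 t, forall q, q \in t -> N (z q) <= 2
    & forall q k, q \in t -> z q k != 0 ->
        (k < q)%N /\ forall p, p \in t -> (p < q)%N -> (p <= k)%N].

(** This formulation retains neither the coefficients of the z q on s nor the
way in which s is cut into pieces, so it is stable under extension of s and t. *)
Let carried (eta : R) (s : seq X) (t : seq nat) (z : nat -> c00 R) : Prop :=
  forall a : nat -> R, exists c, l1norm c s = \sum_(q <- t) `|a q| /\
    `|comb c s - iota (\sum_(q <- t) a q *: z q)| <= eta * \sum_(q <- t) `|a q|.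

Definition l1_blocks (t : seq nat) : Prop := exists2 z, blocks_of t z &
  forall a : nat -> R, kappa / 2 * \sum_(q <- t) `|a q| <= N (\sum_(q <- t) a q *: z q).

(* Half of the lower l_1-constant is given away to the approximation, and the
norms stay below 1 + eta <= 2. *)
Let eta := Num.min 1 (kappa / 2).
Let eta0 : 0 < eta. Proof. by rewrite lt_min ltr01 divr_gt0. Qed.

Let carried_l1 s t z : prefix_closure T s -> blocks_of t z -> carried eta s t z ->
  l1_blocks t.
Proof.
move=> Ts bz cz; exists z => // a; have [c [cs ca]] := cz a.
rewrite -hX.1; have low := Tl1 Ts c; rewrite cs in low.
have sum0 : 0 <= \sum_(q <- t) `|a q| by apply: sumr_ge0.
have : eta * \sum_(q <- t) `|a q| <= kappa / 2 * \sum_(q <- t) `|a q|.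
  by rewrite ler_wpM2r// ge_min lexx orbT.
have := ler_distD (iota (\sum_(q <- t) a q *: z q)) (comb c s) 0.
rewrite !subr0; lra.
Qed.

(* Approximating the vectors of u in c_00 first makes their coordinates
available to [kernel_combination]. *)
Let next_block s t z d u : carried eta s t z -> blocks_of t z ->
  prefix_closure T (s ++ u) -> size u = d.+1 -> (last 0%N t <= d)%N ->
  exists q z', [/\ (d < q)%N, blocks_of (rcons t q) z' & carried eta (s ++ u) (rcons t q) z'].
Proof.
move=> cz [t0 zN zt] Tu ud td.
have [v vP] := choice (fun i => approx u`_i eta0).
have [b [b1 bd]] := kernel_combination d v.
pose w := \sum_(i < d.+1) b i *: v i.
have [n wn] := c00_bounded w.
pose q := (maxn d n).+1.
have tq p : p \in t -> (p < q)%N.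
  by move=> /(path_ltn_le_last t0) pt; rewrite ltnS leq_max (leq_trans pt).
have qt : q \notin t by apply/negP => /tq; rewrite ltnn.
pose z' p := if p == q then w else z p.
have z't p : p \in t -> z' p = z p by rewrite /z'; case: eqP => // -> /tq; rewrite ltnn.
have z'q : z' q = w by rewrite /z' eqxx.
have lb : l1norm b u = 1 by rewrite /l1norm ud.
have wu : `|comb b u - iota w| <= eta.
  rewrite /comb ud linear_sum -sumrB; apply: le_trans (ler_norm_sum _ _ _) _.
  apply: le_trans (_ : \sum_(i < d.+1) `|b i| * eta <= _); last by rewrite -mulr_suml b1 mul1r.
  apply: ler_sum => i _; rewrite linearZ -scalerBr normrZ ler_wpM2l//; exact: vP.
exists q, z'; split; first by rewrite ltnS leq_maxl.
  split.
  - by rewrite rcons_path t0 /= (leq_ltn_trans td)// ltnS leq_maxl.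
  - move=> p; rewrite mem_rcons inE => /orP[/eqP->|pt]; last by rewrite z't// zN.
    rewrite z'q -hX.1.
    have : `|comb b u| <= 1.
      apply: le_trans (ler_norm_sum _ _ _) _; rewrite -[leRHS]lb /l1norm.
      apply: ler_sum => i _; rewrite normrZ (Tunit Tu) ?mulr1//.
      by rewrite mem_cat mem_nth ?orbT.
    have := ler_distD (comb b u) (iota w) 0; rewrite !subr0.
    have : eta <= 1 by rewrite ge_min lexx.
    rewrite distrC in wu; lra.
  - move=> p k; rewrite mem_rcons inE => /orP[/eqP->|pt].
      rewrite z'q => wk.
      have kn : (k < n)%N by rewrite ltnNge; apply: contra wk => /wn ->.
      have dk : (d <= k)%N by rewrite leqNgt; apply: contra wk => /bd wk; rewrite wk.
      split; first by rewrite ltnS leq_max (ltnW kn) orbT.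
      move=> p'; rewrite mem_rcons inE => /orP[/eqP->|p't _]; first by rewrite ltnn.
      exact: leq_trans (leq_trans (path_ltn_le_last t0 p't) td) dk.
    rewrite z't// => /(zt _ _ pt)[kp h]; split=> // p'.
    rewrite mem_rcons inE => /orP[/eqP->|p't]; last exact: h.
    by move=> /ltn_trans/(_ (tq p pt)); rewrite ltnn.
move=> a; have [c [cs ca]] := cz a.
pose c' i := if (i < size s)%N then c i else a q * b (i - size s)%N.
have c's i : (i < size s)%N -> c' i = c i by rewrite /c' => ->.
have c'u i : c' (size s + i)%N = a q * b i by rewrite /c' ltnNge leq_addr addKn.
exists c'; rewrite comb_cat l1norm_cat (eq_comb c's) (eq_l1norm c's) cs.
have -> : l1norm (fun i => c' (size s + i)%N) u = `|a q|.
  rewrite /l1norm; under eq_bigr do rewrite c'u normrM.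
  by rewrite -mulr_sumr -[X in _ * X]/(l1norm b u) lb mulr1.
have -> : comb (fun i => c' (size s + i)%N) u = a q *: comb b u.
  by rewrite /comb scaler_sumr; apply: eq_bigr => i _; rewrite c'u scalerA.
have sumr (W : zmodType) (f : nat -> W) : \sum_(p <- rcons t q) f p = \sum_(p <- t) f p + f q.
  by rewrite -cats1 big_cat big_seq1.
rewrite !sumr; split=> //.
have -> : \sum_(p <- t) a p *: z' p = \sum_(p <- t) a p *: z p.
  by apply: eq_big_seq => p pt; rewrite z't.
rewrite z'q linearD linearZ opprD addrACA -scalerBr mulrDr.
apply: le_trans (ler_normD _ _) _; apply: lerD => //.
by rewrite normrZ mulrC ler_wpM2r.
Qed.

Let block_rank g : forall s t z, xrank_ge (prefix_closure T) (omul oomega g) s ->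
  blocks_of t z -> carried eta s t z -> nrank_ge l1_blocks g t.
Proof.
elim/(well_founded_ind cord_lt_wf): g => g IH s t z Tg bz cz.
constructor; first exact: carried_l1 (rank_ge_here Tg) bz cz.
move=> g' n g'g.
have /rank_geD : xrank_ge (prefix_closure T) (oadd (omul oomega g') oomega) s.
  by apply: rank_ge_le Tg; rewrite -omulS; apply: omul_le; rewrite cord_succ_ltP.
pose d := maxn n (last 0%N t).
move=> /(rank_ge_le (ltW (ofin_lt_omega d.+1)))/rank_ge_steps[u [ud Tu]].
have [q [z' [dq bz' cz']]] := next_block cz bz (rank_ge_here Tu) ud (leq_maxr _ _).
exists q; split; first by apply: leq_ltn_trans dq; apply: leq_maxl.
exact: (IH g' g'g) Tu bz' cz'.
Qed.

(** Each block uses up finitely many vectors, but their number depends on the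
initial segment on which it has to vanish; this costs a factor omega. *)
Lemma l1_blocks_rank g : xrank_ge (prefix_closure T) (omul oomega g) [::] ->
  nrank_ge l1_blocks g [::].
Proof.
move=> Tg; apply: (@block_rank g [::] [::] (fun=> 0) Tg); first by split.
move=> a; exists (fun=> 0); rewrite /l1norm /comb !big_nil !big_ord0.
by rewrite linear0 subr0 normr0 mulr0.
Qed.

End BlockReduction.

Section L1Tree.
Variables (R : realType) (X : normedModType R) (K : R) (T : set (seq X)).
Hypothesis TK : l1_tree K T.

(* For a single norm-one vector the upper constant is at least 1, so the lower
one is at least 1 / K. *)
Let node s : T s -> 0 < K /\ forall c, K^-1 * l1norm c s <= `|comb c s|.
Proof.
move=> Ts; have [[_ _ Tnil] /(_ s Ts)[sunit [c [C [c0 C0 cK h]]]]] := TK.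
have s0 : (0 < size s)%N by case: (s) Ts.
have C1 : 1 <= C.
  have /andP[_] := h (fun i => (i == Ordinal s0)%:R).
  rewrite (bigD1 (Ordinal s0))// eqxx scale1r big1 => [|i /negbTE->]; last by rewrite scale0r.
  rewrite (bigD1 (Ordinal s0))// eqxx normr1 big1 => [|i /negbTE->]; last by rewrite normr0.
  by rewrite /= !addr0 mulr1 sunit// mem_nth.
have K0 : 0 < K by apply: lt_le_trans cK; rewrite mulr_gt0// invr_gt0.
split=> // a; have /andP[+ _] := h (fun i => a i); apply: le_trans.
rewrite ler_wpM2r ?sumr_ge0//.
rewrite ler_pdivrMl// in cK; rewrite -[leLHS]mul1r ler_pdivrMr//.
exact: le_trans C1 cK.
Qed.

Lemma l1_tree_const_gt0 : 0 < K.
Proof. by have [[[s /node[]]]] := TK. Qed.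

Lemma l1_tree_unit s : prefix_closure T s -> forall x, x \in s -> `|x| = 1.
Proof.
move=> [r Tr] x xs; have [_ /(_ _ Tr)[h _]] := TK.
by apply: h; rewrite mem_cat xs.
Qed.

Lemma l1_tree_lower s : prefix_closure T s ->
  forall c, K^-1 * l1norm c s <= `|comb c s|.
Proof.
move=> [r /node[_ low] c].
have := low (fun i => if (i < size s)%N then c i else 0).
rewrite comb_cat l1norm_cat (eq_comb (d := c)) => [|i ->//].
rewrite (eq_l1norm (d := c)) => [|i ->//].
have z i : (if (size s + i < size s)%N then c (size s + i)%N else 0) = 0.
  by rewrite ltnNge leq_addr.
rewrite [comb _ r]big1 => [|i _]; last by rewrite z scale0r.
by rewrite [l1norm _ r]big1 ?addr0// => i _; rewrite z normr0.
Qed.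

End L1Tree.

Lemma l1_block_index_le (R : realType) (X : normedModType R) (e : nat -> X) : (l1_block_index e <= l1_index X)%O.
Proof.
have [_ lub] := xsup_lub [set l1_block_index_const e K | K in [set K : R | 1 <= K]].
apply: lub => _ [K K1 <-].
have [ub _] := xsup_lub [set @l1_index_const R X K | K in [set K : R | 1 <= K]].
apply: le_trans (_ : l1_index_const X K <= _)%O; last by apply: ub; exists K.
have [_ lub] := xsup_lub [set @tree_order X T | T in l1_block_tree e K].
apply: lub => _ [T [TK _] <-].
have [ub' _] := xsup_lub [set @tree_order X T | T in l1_tree K].
by apply: ub'; exists T.
Qed.

(** * The index of the Tsirelson space *)

(** ** Lower bound for the block index *)

Section Space.
Variables (R : realType) (fs : cord -> nat -> cord).
Hypothesis hfs : fundamental_sequences fs.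
Variable alpha : cord.
Hypothesis alpha1 : (oone <= alpha)%O.
Variables (N : c00 R -> R) (X : completeNormedModType R) (iota : {linear c00 R -> X}).
Hypothesis hN : tsirelson_norm (schreier fs alpha) 2^-1 N.
Hypothesis hX : is_completion N iota.
Notation S := (schreier fs alpha).

Let rS : regular S. Proof. exact: (schreier_regular hfs alpha).1. Qed.
Let S1 n : (0 < n)%N -> S [fset n]%fset.
Proof. exact: (schreier_regular hfs alpha).2. Qed.
Let S0 F : S F -> 0%N \notin F. Proof. exact: schreier_gt0. Qed.

Let norm_iota x : `|iota x| = N x. Proof. exact: hX.1. Qed.

Let basis (q : nat) : X := iota (c00_unit R q.-1).

Let branch n (s : seq nat) : Prop :=
  in_family (convolution_power S n) s /\ path ltn 0 s.

Let branch_tree n : set (seq X) :=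
  [set map basis s | s in [set s | branch n s /\ s <> [::]]].

Let sum_coord (s : seq nat) m (x : c00 R) : path ltn 0 s ->
  (forall q, q \in s -> (q <= m)%N) ->
  \sum_(q <- s) `|x q.-1| = \sum_(k < m | k.+1 \in [fset q in s]%fset) `|x k|.
Proof.
move=> s0 sm.
have us : uniq s by apply: (sorted_uniq ltn_trans ltnn); case: (s) s0 => //= q l /andP[].
have pos q : q \in s -> q.-1.+1 = q by move=> /(path_ltn_gt s0)/prednK.
rewrite -(big_mkord (fun k => k.+1 \in [fset q in s]%fset) (fun k => `|x k|)).
rewrite -[LHS](big_map predn xpredT (fun k => `|x k|)) -[RHS]big_filter.
apply: perm_big; apply: uniq_perm.
- by rewrite map_inj_in_uniq// => p q /pos pE /pos qE /= pq; rewrite -pE -qE pq.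
- by rewrite filter_uniq// iota_uniq.
move=> k; rewrite mem_filter mem_index_iota !inE /=; apply/mapP/andP.
  by move=> [q qs ->]; rewrite pos// sm.
by move=> [ks _]; exists k.+1.
Qed.

Let branch_l1 n s (a : nat -> R) : branch n s ->
  2^-1 ^+ n * (\sum_(i < size s) `|a i|) <=
    `|\sum_(i < size s) a i *: (map basis s)`_i|.
Proof.
move=> [Ps s0]; pose x : c00 R := \sum_(i < size s) a i *: c00_unit R (nth 0%N s i).-1.
have us : uniq s by apply: (sorted_uniq ltn_trans ltnn); case: (s) s0 => //= q l /andP[].
have -> : \sum_(i < size s) a i *: (map basis s)`_i = iota x.
  rewrite linear_sum; apply: eq_bigr => i _.
  by rewrite linearZ/= (nth_map 0%N).
rewrite norm_iota.
have xE i : (i < size s)%N -> x (nth 0%N s i).-1 = a i.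
  move=> ik; rewrite c00_sum; under eq_bigr do rewrite c00Z /=.
  rewrite (bigD1 (Ordinal ik))//= eqxx mulr1 big1 ?addr0// => j ji.
  case: eqP => [eqij|_]; last by rewrite mulr0.
  have pos k : (k < size s)%N -> (nth 0%N s k).-1.+1 = nth 0%N s k.
    by move=> ks; rewrite prednK//; apply: (path_ltn_gt s0); apply: mem_nth.
  move/negP: ji; case; rewrite -val_eqE/= -(nth_uniq 0%N _ _ us)//.
  by rewrite -(pos j)// -(pos i)// eqij.
pose m := \max_(q <- s) q.
apply: le_trans (_ : 2^-1 ^+ n * (\sum_(k < m | k.+1 \in [fset q in s]%fset) `|x k|) <= _); last first.
  exact: (tnorm_convolution_power rS hN).
rewrite -(sum_coord x s0) => [|q qs]; last exact: (@leq_bigmax_seq _ s xpredT id q qs isT).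
rewrite (big_nth 0%N) big_mkord ler_wpM2l ?exprn_ge0 ?invr_ge0//.
by apply: ler_sum => i _; rewrite xE.
Qed.

Let norm_basis q : `|basis q| = 1.
Proof. by rewrite norm_iota (tnorm_unit S1 hN). Qed.

Let branch_tree_l1 n : l1_block_tree (fun k => iota (c00_unit R k)) (2 ^+ n) (branch_tree n).
Proof.
have rank := @nrank_ge_sorted _ _ 0 (schreier_power_rank hfs alpha n).
split; [split; [split|]|].
- have [y [_ Py]] := rank_ge_next 0%N rank (omegapow_gt0 _).
  by exists (map basis [:: y]), [:: y] => //; split=> //; apply: rank_ge_here Py.
- by apply: sub_countable (card_image_le _ _) _; apply: countableP.
- by move=> [s [_ s0]]; case: s s0.
- move=> _ [s [Bs _] <-]; split.
    by move=> _ /mapP[q _ ->]; apply: norm_basis.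
  have pow0 : 0 < 2^-1 ^+ n :> R by rewrite exprn_gt0// invr_gt0.
  exists (2^-1 ^+ n), 1; split=> //.
    by rewrite mulr1 -exprVn invrK.
  move=> a; pose a' i := if insub i is Some j then a j else 0.
  have a'E (i : 'I_(size (map basis s))) : a' i = a i by rewrite /a' valK.
  apply/andP; split.
    rewrite (eq_bigr (fun i : 'I__ => `|a' i|)) => [|i _]; last by rewrite a'E.
    rewrite [X in _ <= `|X|](eq_bigr (fun i : 'I__ => a' i *: (map basis s)`_i)) => [|i _]; last by rewrite a'E.
    by rewrite size_map; apply: branch_l1.
  rewrite mul1r; apply: le_trans (ler_norm_sum _ _ _) _; apply: ler_sum => i _.
  have := ltn_ord i; rewrite [X in (_ < X)%N -> _]size_map => ik.
  by rewrite normrZ (nth_map 0%N)// norm_basis mulr1.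
- move=> _ [s [[_ s0] _] <-].
  have pos i : (i < size s)%N -> (nth 0%N s i).-1.+1 = nth 0%N s i.
    by move=> ks; rewrite prednK//; apply: (path_ltn_gt s0); apply: mem_nth.
  exists (fun j => [fset (nth 0%N s j).-1]%fset), (fun _ _ => 1); rewrite size_map.
  split=> [j js|j js].
    split; first by apply: (@mem_fset_neq0 _ (nth 0%N s j).-1); rewrite inE.
      by move=> i _; apply: oner_neq0.
    by rewrite big_seq_fset1 scale1r (nth_map 0%N).
  apply/allrelP => p q; rewrite !inE => /eqP-> /eqP->.
  rewrite /= -ltnS !pos ?(ltnW js)//.
  have := s0; rewrite path_sortedE; last exact: ltn_trans.
  by move=> /andP[_ /(sortedP 0%N)/(_ j js)].
Qed.

Lemma l1_block_index_ge : (Countable_ord (omegapow (omul alpha oomega)) <=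
  l1_block_index (fun k => iota (c00_unit R k)))%O.
Proof.
have pow n : (Countable_ord (omegapow (omul alpha (ofin n))) <=
    l1_block_index (fun k => iota (c00_unit R k)))%O.
  have rank := @nrank_ge_sorted _ _ 0 (schreier_power_rank hfs alpha n).
  have {}rank : (Countable_ord (omegapow (omul alpha (ofin n))) <=
    tree_order (branch_tree n))%O := rank_tree_order basis rank.
  apply: (le_trans rank).
  have [ub _] := xsup_lub [set l1_block_index_const (fun k => iota (c00_unit R k)) K | K in [set K : R | 1 <= K]].
  have {}ub : (l1_block_index_const (fun k => iota (c00_unit R k)) (2 ^+ n) <=
      l1_block_index (fun k => iota (c00_unit R k)))%O.
    by apply: ub; exists (2 ^+ n) => //=; rewrite exprn_ege1// ler1n.
  apply: le_trans ub.
  have [ub' _] := xsup_lub [set @tree_order X T | T in l1_block_tree (fun k => iota (c00_unit R k)) (2 ^+ n)].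
  by apply: ub'; exists (branch_tree n).
case: (l1_block_index _) pow => [b|] pow //.
suff : (omegapow (omul alpha oomega) <= b)%O by [].
by apply: (omegapow_omul_omega_lub alpha1) => n; apply: pow.
Qed.

(** ** Upper bound for the index *)

Lemma exp_half_lt (e : R) : 0 < e -> exists k, 2^-1 ^+ k < e.
Proof.
move=> e0; have /archi_boundP : 0 <= e^-1 by rewrite invr_ge0 ltW.
set k := Num.bound _ => ek; exists k.
rewrite exprVn invf_plt ?posrE ?exprn_gt0//; apply: lt_le_trans ek _.
by rewrite -natrX ler_nat ltnW// ltn_expl.
Qed.

(** Smallness of S^k provides a convex combination of blocks whose norm is about
2 ^ - k by [tnorm_blocks], below the l_1-constant of the blocks. *)
Lemma l1_tree_order_le K T : l1_tree K T ->
  (@tree_order X T <= Countable_ord (omegapow (omul alpha oomega)))%O.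
Proof.
move=> TK; apply: tree_order_le => Trank.
have K0 := l1_tree_const_gt0 TK; pose kappa := K^-1.
have kappa0 : 0 < kappa by rewrite invr_gt0.
have [k kE] : exists k, 2^-1 ^+ k < kappa / 8 by apply: exp_half_lt; rewrite divr_gt0.
pose e := kappa / 8 / k.+1%:R.
have e0 : 0 < e by rewrite !divr_gt0.
have [xi xilt sxi] := schreier_power_small hfs R k alpha1.
have Tw : xrank_ge (prefix_closure T) (omul oomega (omegapow xi)) [::].
  apply: rank_ge_le Trank; apply: le_trans (omega_mul_omegapow xi) _.
  by apply: omegapow_le; rewrite cord_succ_ltP.
have := l1_blocks_rank hX kappa0 (l1_tree_unit TK) (l1_tree_lower TK) Tw.
move=> /(sxi _ _ e0)[t [a [[z [t0 zN zt] low] a0 suma aG]]].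
have ut : uniq t by apply: (sorted_uniq ltn_trans ltnn); case: (t) t0 => //= q l /andP[].
have tpos q : q \in t -> (0 < q)%N by apply: path_ltn_gt.
have [G [PG _ up]] := tnorm_blocks rS S1 hN S0 ut tpos a0 zN zt k [fset q in t]%fset.
have tE (W : zmodType) (f : nat -> W) : \sum_(q <- t | q \in [fset q in t]%fset) f q = \sum_(q <- t) f q.
  rewrite big_seq_cond [RHS]big_seq; apply: eq_bigl => q; rewrite !inE.
  by case: (q \in t).
have := low a; have -> : \sum_(q <- t) `|a q| = 1.
  by rewrite -suma; apply: eq_bigr => q _; rewrite ger0_norm.
move: up; rewrite /= /mass !tE suma !mulr1 => up lo.
have {lo}up := le_trans lo up.
have kG : k%:R * (\sum_(q <- t | q \in G) a q) <= kappa / 8.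
  apply: le_trans (_ : k.+1%:R * e <= _); last by rewrite /e mulrC divfK// pnatr_eq0.
  apply: ler_pM => //; [exact: sumr_ge0|by rewrite ler_nat|exact: aG].
by move: up kG kE; lra.
Qed.

Lemma l1_index_le : (l1_index X <= Countable_ord (omegapow (omul alpha oomega)))%O.
Proof.
have [_ lub] := xsup_lub [set @l1_index_const R X K | K in [set K : R | 1 <= K]].
apply: lub => _ [K _ <-].
have [_ lub] := xsup_lub [set @tree_order X T | T in l1_tree K].
by apply: lub => _ [T TK <-]; apply: l1_tree_order_le TK.
Qed.

End Space.

Theorem theorem5p19 (R : realType)
  (fs : cord -> nat -> cord) (hfs : fundamental_sequences fs)
  (alpha : cord) (halpha : (oone <= alpha)%O)
  (N : c00 R -> R) (hN : tsirelson_norm (schreier fs alpha) 2^-1 N)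
  (X : completeNormedModType R) (iota : {linear c00 R -> X})
  (hX : is_completion N iota) :
  l1_block_index (fun k => iota (c00_unit R k))
    = Countable_ord (oexp oomega (omul alpha oomega)) /\
  Countable_ord (oexp oomega (omul alpha oomega)) = l1_index X.
Proof.
have ge := l1_block_index_ge hfs halpha hN hX.
have bi := l1_block_index_le (fun k => iota (c00_unit R k)).
have le := l1_index_le hfs halpha hN hX.
by split; apply/le_anti/andP; split=> //;
  [exact: le_trans bi le|exact: le_trans ge bi].
Qed.
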